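(* Let $(m_t)_{t\ge0}$ be a smooth solution of $$\partial_t m+\partial_x(mH[m])=0\quad\text{in }(0,\infty)\times\mathbb{R}$$ valued in $\mathcal{P}_2(\mathbb{R})$ and such that $E(m_0)>-\infty$. Then for any $0\le t'\le t$, $$E(m_t)=E(m_{t'})+\int_{t'}^{t}\int_{\mathbb{R}}H[m_s](x)^2\,m_s(dx)\,ds.$$
   Context: $\mathcal{P}_2(\mathbb{R})$ is the set of Borel probability measures on $\mathbb{R}$ with finite second moment. $H$ is the (unnormalized) Hilbert transform, $H[m]=\mathrm{p.v.}(1/x)*m$, i.e. $H[u](x)=\int_{\mathbb{R}}\frac{u(y)-u(x)}{x-y}dy=\mathrm{p.v.}\int_{\mathbb{R}}\frac{u(y)}{x-y}dy$ for smooth densities $u$. The free entropy $E:\mathcal{P}_2(\mathbb{R})\to\mathbb{R}\cup\{-\infty\}$ is $$E(\mu)=\frac12\int_{\mathbb{R}}\int_{\mathbb{R}}\log(|x-y|)\,\mu(dx)\mu(dy).$$ *)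

(* Defs.v *)
From HB Require Import structures.
From mathcomp Require Import all_boot all_order all_algebra.
From mathcomp Require Import all_classical all_reals all_analysis.

Set Implicit Arguments.
Unset Strict Implicit.
Unset Printing Implicit Defensive.

Import Order.TTheory GRing.Theory Num.Theory.
Import numFieldNormedType.Exports.

Local Open Scope classical_set_scope.
Local Open Scope ring_scope.

Section Defs.
Context {R : realType}.
Local Notation borelR := (measurableTypeR R).

Definition finite_second_moment (mu : probability borelR R) : Prop :=
  (\int[mu]_x (x ^+ 2)%:E < +oo)%E.

(* [lne] is used rather than [ln] because [ln 0 = 0], whereas the kernel must
   be [-oo] on the diagonal: a measure with an atom has free entropy [-oo]. *)
Definition free_entropy (mu : probability borelR R) : \bar R :=
  ((2^-1)%:E * \int[mu]_x \int[mu]_y lne (`|x - y|%:E))%E.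

(* Principal value of [(1/x) * mu]; it is a genuine limit wherever [mu] has a
   C^1 density near [x]. *)
Definition hilbert (mu : probability borelR R) (x : R) : R :=
  lim ((\int[mu]_(y in [set y | e < `|x - y|]) (x - y)^-1) @[e --> 0^'+]).

(* [U] is meant to be open. *)
Fixpoint Ck_on (V : normedModType R) (k : nat) (U : set V) (f : V -> R^o)
    : Prop :=
  match k with
  | 0%N => forall p, U p -> {for p, continuous f}
  | k'.+1 => [/\ forall p, U p -> {for p, continuous f},
                forall v p, U p -> derivable f p v
              & forall v, Ck_on k' U ('D_v f)]
  end.

Definition smooth_on (V : normedModType R) (U : set V) (f : V -> R^o) : Prop :=
  forall k, Ck_on k U f.

Definition has_density (mu : probability borelR R) (u : R -> R) : Prop :=
  (forall x, 0 <= u x) /\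
  forall A : set borelR, measurable A ->
    mu A = (\int[lebesgue_measure]_(x in A) (u x)%:E)%E.

Definition narrow_cvg (F : set_system R) (m : R -> probability borelR R)
    (mu : probability borelR R) : Prop :=
  forall f : R -> R, continuous f -> (exists M : R, forall x, `|f x| <= M) ->
    (\int[m t]_x f x) @[t --> F] --> \int[mu]_x f x.

(* Only the values [m t] with [0 <= t] matter. The initial condition is taken
   in the narrow sense; [m 0] need not have a density. *)
Definition smooth_solution (m : R -> probability borelR R) : Prop :=
  exists u : R * R -> R,
    [/\ smooth_on [set p : R^o * R^o | 0 < p.1] u,
        forall t : R, 0 < t -> has_density (m t) (fun x : R => u (t, x)),
        forall t x : R, 0 < t ->
          derivable (fun y : R => u (t, y) * hilbert (m t) y : R^o) x 1 /\
          derive1 (fun s : R => u (s, x)) t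
            + derive1 (fun y : R => u (t, y) * hilbert (m t) y) x = 0
      & narrow_cvg 0^'+ m (m 0)].

End Defs.

(* Main.v *)
(* Replace the logarithm by [k_e h = ln (h^2 + e^2) / 2], whose derivative is
   [q_e h = h / (h^2 + e^2)], and put [H_e = q_e * m].  Since the kernel of [H]
   is odd,
     [\int psi H dm = 1/2 \iint (psi x - psi y) / (x - y) dm dm],
   so the equation can be tested against every [psi] whose derivative is
   bounded and Lipschitz, and the entropy of [m_t] with kernel [k_e] has time
   derivative
     [D_e = 1/2 \iint (H_e x - H_e y) / (x - y) dm dm = \int H_e H dm].
   Symmetrizing a triple integral gives [\int H_e^2 dm <= 2 D_e].  If
   [\int H^2 dm] is finite, Cauchy-Schwarz bounds [H_e] in [L^2(m)], so that
   [H_e -> H] weakly and [D_e -> \int H^2 dm] with [0 <= D_e <= 2 \int H^2 dm];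
   if it is infinite, Fatou's lemma gives the same conclusion.  When
   [e -> 0], the entropies converge monotonically and, [D_e] being
   nonnegative, Fatou's lemma in time makes the dissipation integrable; the
   bound on [D_e] then allows dominated convergence in time. *)
Require Import Defs.
From HB Require Import structures.
From mathcomp Require Import all_boot all_order all_algebra.
From mathcomp Require Import all_classical all_reals all_analysis.
From mathcomp Require Import measurable_realfun ring lra.
Import Order.TTheory GRing.Theory Num.Theory.
Import numFieldNormedType.Exports.
Set Implicit Arguments.
Unset Strict Implicit.
Unset Printing Implicit Defensive.
Local Open Scope classical_set_scope.
Local Open Scope ring_scope.

(** The smoothness of [u] is only local: no hypothesis controls [u], its derivatives or [H] at
    infinity, [H] is not known to be integrable against [m_t], and at time [0] only narrow
    continuity is available. What survives is [pair_form], which is bounded by the Lipschitz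
    constant of the test function whatever the measure, so limits over cut-offs and in time are
    taken in that form. Continuity in time needs no estimate: the densities converge pointwise and
    have mass one, hence converge in L^1 by Scheffe's lemma. The natural test function, the
    potential of [m_t], moves with [t]. Since the entropy is a symmetric quadratic form in the
    measure, its increment splits into two increments with a frozen potential, and the potential is
    never differentiated in time. The bound on [H_e] rests on the identity [1/((a-b)(a-c)) +
    1/((b-c)(b-a)) + 1/((c-a)(c-b)) = 0], whose regularized version keeps a favourable sign. *)

Section integration.
Context {R : realType}.
Local Notation borelR := (measurableTypeR R).
Local Notation leb := (@lebesgue_measure R).

(** * Integrals of real-valued functions: domination, densities, Fubini *)

Lemma dominated_integrable d (T : measurableType d)
    (mu : {measure set T -> \bar R}) (D : set T) (f g : T -> R) :
  measurable D -> measurable_fun D f -> mu.-integrable D (EFin \o g) ->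
  (forall x, D x -> `|f x| <= g x) -> mu.-integrable D (EFin \o f).
Proof.
move=> mD mf ig fg; apply: (le_integrable mD _ _ ig).
  exact/measurable_EFinP.
by move=> x Dx /=; rewrite lee_fin (le_trans (fg x Dx))// ler_norm.
Qed.

Lemma integrable_EFinD d (T : measurableType d)
    (mu : {measure set T -> \bar R}) (D : set T) (f g : T -> R) :
  measurable D -> mu.-integrable D (EFin \o f) -> mu.-integrable D (EFin \o g) ->
  mu.-integrable D (EFin \o (fun x => f x + g x)).
Proof.
move=> mD fi gi; rewrite /comp; under eq_fun do rewrite EFinD.
exact: integrableD.
Qed.

Lemma integrable_EFinB d (T : measurableType d)
    (mu : {measure set T -> \bar R}) (D : set T) (f g : T -> R) :
  measurable D -> mu.-integrable D (EFin \o f) -> mu.-integrable D (EFin \o g) ->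
  mu.-integrable D (EFin \o (fun x => f x - g x)).
Proof.
move=> mD fi gi; rewrite /comp; under eq_fun do rewrite EFinB.
exact: integrableB.
Qed.

Lemma integrable_EFinZl d (T : measurableType d)
    (mu : {measure set T -> \bar R}) (D : set T) (k : R) (f : T -> R) :
  measurable D -> mu.-integrable D (EFin \o f) ->
  mu.-integrable D (EFin \o (fun x => k * f x)).
Proof.
move=> mD fi; rewrite /comp; under eq_fun do rewrite EFinM.
exact: integrableZl.
Qed.

Lemma bounded_integrable d (T : measurableType d)
    (mu : probability T R) (f : T -> R) (C : R) :
  measurable_fun setT f -> (forall x, `|f x| <= C) ->
  mu.-integrable setT (EFin \o f).
Proof.
move=> mf fC; apply: (@dominated_integrable _ _ _ _ _ (cst C)) => //.
exact: finite_measure_integrable_cst.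
Qed.

Lemma Rdominated_convergence d (T : measurableType d)
    (mu : {measure set T -> \bar R}) (D : set T) (f_ : nat -> T -> R)
    (f g : T -> R) :
  measurable D -> (forall n, measurable_fun D (f_ n)) ->
  mu.-integrable D (EFin \o g) ->
  (forall n x, D x -> `|f_ n x| <= g x) ->
  (forall x, D x -> f_ n x @[n --> \oo] --> f x) ->
  mu.-integrable D (EFin \o f) /\
  \int[mu]_(x in D) f_ n x @[n --> \oo] --> \int[mu]_(x in D) f x.
Proof.
move=> mD mf_ ig fg ff.
have mf : measurable_fun D f by exact: measurable_fun_cvg ff.
have [ ] := @dominated_convergence _ T R mu D mD (fun n => EFin \o f_ n)
  (EFin \o f) (EFin \o g).
- by move=> n; exact/measurable_EFinP.
- exact/measurable_EFinP.
- by apply: aeW => x Dx; apply: cvg_EFin (ff x Dx); exact: nearW.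
- exact: ig.
- by apply: aeW => x n Dx /=; rewrite lee_fin fg.
move=> fi _ cf; split => //.
apply: fine_cvg; rewrite fineK; first exact: cf.
exact: integrable_fin_num.
Qed.

Lemma bounded_convergence d (T : measurableType d)
    (mu : probability T R) (f_ : nat -> T -> R) (f : T -> R) (C : R) :
  (forall n, measurable_fun setT (f_ n)) ->
  (forall n x, `|f_ n x| <= C) ->
  (forall x, f_ n x @[n --> \oo] --> f x) ->
  \int[mu]_x f_ n x @[n --> \oo] --> \int[mu]_x f x.
Proof.
move=> mf fC ff.
have [||| _ ? //] :=
  @Rdominated_convergence _ _ mu setT f_ f (cst C) measurableT mf.
- exact: finite_measure_integrable_cst.
- by move=> n x _; exact: fC.
- by move=> x _; exact: ff.
Qed.

Lemma Rintegral_probability_cst d (T : measurableType d)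
    (mu : probability T R) (C : R) : \int[mu]_x C = C.
Proof. by rewrite Rintegral_cst//= [X in fine X]probability_setT mulr1. Qed.

Lemma Rintegral_bound d (T : measurableType d)
    (mu : probability T R) (f : T -> R) (C : R) :
  measurable_fun setT f -> (forall x, `|f x| <= C) ->
  `|\int[mu]_x f x| <= C.
Proof.
move=> mf fC; have fi := @bounded_integrable _ _ mu f C mf fC.
rewrite (le_trans (le_normr_Rintegral _ fi))//.
rewrite -[leRHS](Rintegral_probability_cst mu).
apply: le_Rintegral => //; last exact: finite_measure_integrable_cst.
exact: integrable_norm.
Qed.

Section density.
Variables (mu : probability borelR R) (v : R -> R).
Hypothesis mv : measurable_fun setT v.
Hypothesis muv : has_density mu v.

Import HBNNSimple.

(** [has_density] speaks of sets only, so the formula is checked on level sets of simple functions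
    and carried to [f] by monotone convergence on both sides. *)
Lemma ge0_integral_density (f : R -> \bar R) :
  measurable_fun [set: borelR] f -> (forall x, (0 <= f x)%E) ->
  (\int[mu]_x f x = \int[leb]_x (f x * (v x)%:E))%E.
Proof.
move=> mf f0; have v0 := muv.1.
have mv' : measurable_fun [set: borelR] (EFin \o v) by exact/measurable_EFinP.
pose h := nnsfun_approx (@measurableT _ borelR) mf.
have ndh x (a b : nat) : (a <= b)%N -> h a x <= h b x.
  by move=> ab; exact/lefP/nd_nnsfun_approx.
have hf x : (h n x)%:E @[n --> \oo] --> f x.
  by apply: cvg_nnsfun_approx => // y _; exact: f0.
have -> : (\int[mu]_x f x)%E = limn (fun n => (\int[mu]_x (h n x)%:E)%E).
  rewrite -monotone_convergence//.
  - by apply: eq_integral => x _; apply/esym/cvg_lim.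
  - by move=> n; exact/measurable_EFinP/measurable_funP.
  - by move=> n x _; rewrite lee_fin.
  - by move=> x _ a b ab; rewrite lee_fin ndh.
have -> : (\int[leb]_x (f x * (v x)%:E))%E =
    limn (fun n => (\int[leb]_x ((h n x)%:E * (v x)%:E))%E).
  rewrite -monotone_convergence//.
  - apply: eq_integral => x _; apply/esym/cvg_lim => //.
    by apply: cvgeZr => //; exact: hf.
  - move=> n; apply: emeasurable_funM => //.
    exact/measurable_EFinP/measurable_funP.
  - by move=> n x _; rewrite mule_ge0// lee_fin.
  - by move=> x _ a b ab; rewrite lee_wpmul2r ?lee_fin ?ndh.
congr (limn _); apply/funext => n.
have mB r : measurable (h n @^-1` [set r]).
  by rewrite -[X in measurable X]setTI; exact: measurable_funP.
transitivity (\sum_(k \in range (h n))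
    \int[mu]_x (k * \1_(h n @^-1` [set k]) x)%:E)%E.
  under eq_integral do rewrite fimfunE -fsumEFin//.
  rewrite ge0_integral_fsum//.
  - by move=> r; exact/measurable_EFinP/measurable_funM.
  - by move=> r x _; rewrite ?EFinM ?nnfun_muleindic_ge0.
transitivity (\sum_(k \in range (h n))
    \int[leb]_x ((k * \1_(h n @^-1` [set k]) x)%:E * (v x)%:E))%E; last first.
  rewrite -ge0_integral_fsum//; last 2 first.
  - move=> r; apply: emeasurable_funM => //.
    by apply/measurable_EFinP; exact/measurable_funM.
  - move=> r x _; rewrite mule_ge0 ?lee_fin // -lee_fin EFinM.
    exact: nnfun_muleindic_ge0.
  apply: eq_integral => x _; rewrite -ge0_mule_fsuml; last first.
    by move=> r; rewrite ?EFinM ?nnfun_muleindic_ge0.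
  by rewrite fsumEFin// -fimfunE.
apply: eq_fsbigr => r /set_mem[y _ hy].
have r0 : 0 <= r by rewrite -hy.
rewrite integralZl_indic_nnsfun// integral_indic// setIT.
rewrite [X in (_ * X)%E](muv.2 _ (mB r)).
under [RHS]eq_integral do rewrite EFinM -muleA.
rewrite ge0_integralZl//; last 2 first.
- by apply: emeasurable_funM => //; exact/measurable_EFinP.
- by move=> x _; rewrite mule_ge0// lee_fin.
congr (_ * _)%E.
rewrite [LHS]integral_mkcond; apply: eq_integral => x _.
rewrite patchE indicE; case: ifPn => _; [by rewrite mul1e|by rewrite mul0e].
Qed.

Lemma integrable_density (f : R -> R) : measurable_fun setT f ->
  mu.-integrable setT (EFin \o f) <->
  leb.-integrable setT (EFin \o (fun x => f x * v x)).
Proof.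
move=> mf; have v0 := muv.1.
have e : (\int[mu]_x `|(f x)%:E| = \int[leb]_x `|(f x * v x)%:E|)%E.
  rewrite ge0_integral_density//; last first.
    by apply/measurable_EFinP; exact: measurableT_comp.
  by apply: eq_integral => x _; rewrite /= normrM (ger0_norm (v0 x)).
split=> /integrableP[_ fi]; apply/integrableP; split.
- by apply/measurable_EFinP; exact: measurable_funM.
- by rewrite /= -e.
- exact/measurable_EFinP.
- by rewrite /= e.
Qed.

Lemma Rintegral_density (f : R -> R) : measurable_fun setT f ->
  \int[mu]_x f x = \int[leb]_x (f x * v x).
Proof.
move=> mf; have v0 := muv.1; congr fine; rewrite [LHS]integralE [RHS]integralE; congr (_ - _)%E.
  rewrite ge0_integral_density//; last first.
    by apply: measurable_funepos; exact/measurable_EFinP.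
  apply: eq_integral => x _.
  by rewrite !funeposE -!EFin_max -EFinM maxr_pMl// mul0r.
rewrite ge0_integral_density//; last first.
  by apply: measurable_funeneg; exact/measurable_EFinP.
apply: eq_integral => x _.
by rewrite !funenegE -!EFinN -!EFin_max -EFinM maxr_pMl// mul0r mulNr.
Qed.

Lemma integrable_density1 : leb.-integrable setT (EFin \o v).
Proof.
rewrite (_ : EFin \o v = EFin \o (fun x => 1 * v x)); last first.
  by apply/funext => x /=; rewrite mul1r.
apply: (integrable_density _).1 => //.
exact: finite_measure_integrable_cst.
Qed.

End density.


(** Duality between L^1 and bounded functions: closeness of densities in total variation passes to
    every bounded observable, whence all continuity in time later on. *)
Lemma Rintegral_density_sub (mu nu : probability borelR R) (v w f : R -> R)
    (C : R) :
  measurable_fun setT v -> has_density mu v ->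
  measurable_fun setT w -> has_density nu w ->
  measurable_fun setT f -> (forall x, `|f x| <= C) ->
  `|\int[mu]_x f x - \int[nu]_x f x| <= C * \int[leb]_x `|v x - w x|.
Proof.
move=> mv muv mw nuw mf fC.
have iv := integrable_density1 mv muv; have iw := integrable_density1 mw nuw.
rewrite (Rintegral_density mv muv mf) (Rintegral_density mw nuw mf).
have fv : leb.-integrable setT (EFin \o (fun x => f x * v x)).
  by apply/(integrable_density mv muv mf); exact: (@bounded_integrable _ _ mu f C).
have fw : leb.-integrable setT (EFin \o (fun x => f x * w x)).
  by apply/(integrable_density mw nuw mf); exact: (@bounded_integrable _ _ nu f C).
have ivw : leb.-integrable setT (EFin \o (fun x => `|v x - w x|)).
  apply: integrable_norm; rewrite /comp; under eq_fun do rewrite EFinB.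
  exact: integrableB.
rewrite -RintegralB// -RintegralZl//.
have ifvw : leb.-integrable setT (EFin \o (fun x => f x * v x - f x * w x)).
  by rewrite /comp; under eq_fun do rewrite EFinB; exact: integrableB.
rewrite (le_trans (le_normr_Rintegral _ ifvw))//.
apply: le_Rintegral => //; first exact: integrable_norm.
  by rewrite /comp; under eq_fun do rewrite EFinM; exact: integrableZl.
by move=> x _; rewrite -mulrBr normrM ler_wpM2r.
Qed.

(* Scheffe's lemma: [|v_n - v| = (v_n - v) + 2 (v - v_n)^+], where the first
   term has integral zero and the second one is dominated by [v]. *)
Lemma scheffe (mu : nat -> probability borelR R) (nu : probability borelR R)
    (v : nat -> R -> R) (w : R -> R) :
  (forall n, measurable_fun setT (v n)) -> measurable_fun setT w ->
  (forall n, has_density (mu n) (v n)) -> has_density nu w ->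
  (forall x, v n x @[n --> \oo] --> w x) ->
  \int[leb]_x `|v n x - w x| @[n --> \oo] --> 0.
Proof.
move=> mv mw muv nuw vw.
have iv n := integrable_density1 (mv n) (muv n).
have iw := integrable_density1 mw nuw.
have v0 n x : 0 <= v n x by exact: (muv n).1.
have w0 x : 0 <= w x by exact: nuw.1.
have mass (P : probability borelR R) u : measurable_fun setT u ->
    has_density P u -> \int[leb]_x u x = 1.
  move=> mu' Pu; rewrite -[RHS](Rintegral_probability_cst P).
  rewrite (Rintegral_density mu' Pu)//.
  by under [RHS]eq_Rintegral do rewrite mul1r.
pose p n x := 2^-1 * (`|w x - v n x| + (w x - v n x)).
have mp n : measurable_fun setT (p n).
  apply: measurable_funM => //; apply: measurable_funD.
    by apply: measurableT_comp => //; exact: measurable_funB.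
  exact: measurable_funB.
have pw n x : `|p n x| <= w x.
  rewrite /p; case: (leP 0 (w x - v n x)) => h.
    by rewrite [`|w x - _|]ger0_norm// ger0_norm; have := v0 n x; lra.
  by rewrite [`|w x - _|]ltr0_norm// addNr mulr0 normr0.
have ip n : leb.-integrable setT (EFin \o p n).
  apply: (@dominated_integrable _ _ leb setT (p n) w);
    [by []|exact: mp|exact: iw|by move=> x _; exact: pw].
have [|||_ cp] := @Rdominated_convergence _ _ leb setT p (cst 0) w measurableT mp.
- exact: iw.
- by move=> n x _; exact: pw.
- move=> x _; rewrite /p /= -[X in _ --> X](mulr0 2^-1); apply: cvgMr.
  have d0 : w x - v n x @[n --> \oo] --> 0.
    by rewrite -(subrr (w x)); apply: cvgB; [exact: cvg_cst|exact: vw].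
  rewrite -(addr0 (0 : R)) -{1}(normr0 R); apply: cvgD => //.
  exact: cvg_norm.
rewrite Rintegral_cst// mul0r in cp.
have -> : (fun n => \int[leb]_x `|v n x - w x|) =
    (fun n => (\int[leb]_x p n x) * 2).
  apply/funext => n; have ivn := iv n; have ipn := ip n.
  have e x : `|v n x - w x| = (v n x - w x) + p n x * 2.
    by rewrite /p distrC; lra.
  under eq_Rintegral do rewrite e.
  rewrite RintegralD//; last 2 first.
  - by rewrite /comp; under eq_fun do rewrite EFinB; exact: integrableB.
  - by rewrite /comp; under eq_fun do rewrite EFinM; exact: integrableZr.
  rewrite RintegralB// RintegralZr//.
  by rewrite (mass _ _ (mv n) (muv n)) (mass _ _ mw nuw) subrr add0r.
by rewrite -(mul0r 2); apply: cvgMl.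
Qed.

Section fubini.
Context d1 d2 (T1 : measurableType d1) (T2 : measurableType d2).
Variables (mu : probability T1 R) (nu : probability T2 R).
Variables (f : T1 -> T2 -> R) (g : T1 -> R) (h : T2 -> R).
Hypothesis mf : measurable_fun [set: T1 * T2] (fun z => f z.1 z.2).
Hypothesis ig : mu.-integrable setT (EFin \o g).
Hypothesis ih : nu.-integrable setT (EFin \o h).
Hypothesis fgh : forall x y, `|f x y| <= g x + h y.

(** A bound [g x + h y] is what the logarithmic kernel satisfies against measures with a first
    moment. By Tonelli the double integral is at most the sum of the two L^1 norms, both measures
    having mass one. *)
Lemma integrable_product :
  (mu \x nu)%E.-integrable setT (EFin \o (fun z => f z.1 z.2)).
Proof.
have mEf : measurable_fun setT (EFin \o (fun z : T1 * T2 => f z.1 z.2)).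
  exact/measurable_EFinP.
apply/(integrable12ltyP _ _ mEf).
have := ih => /integrableP[mh]; set c := (\int[nu]_y _)%E => cfin.
have c0 : (0 <= c)%E by exact: integral_ge0.
have cE : c = (fine c)%:E by rewrite fineK// ge0_fin_numE.
have mg : measurable_fun setT g by apply/measurable_EFinP; exact: measurable_int ig.
apply: (@le_lt_trans _ _ (\int[mu]_x (`|g x| + fine c)%:E)%E).
  apply: ge0_le_integral => //.
  - by move=> x _; exact: integral_ge0.
  - apply: (@measurable_fun_fubini_tonelli_F _ _ T1 T2 R nu
        (abse \o (EFin \o (fun z : T1 * T2 => f z.1 z.2)))).
      exact: measurableT_comp.
    by move=> z; exact: abse_ge0.
  - apply/measurable_EFinP; apply: measurable_funD => //.
    exact: measurableT_comp.
  - move=> x _; rewrite EFinD -cE.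
    have -> : (`|g x|%:E = \int[nu]_y `|g x|%:E)%E.
      by rewrite integral_cst// [X in (_ * X)%E]probability_setT mule1.
    rewrite /c -ge0_integralD//; last by apply: measurableT_comp.
    apply: ge0_le_integral => //.
    + apply: measurableT_comp => //.
      exact: (measurableT_comp mEf (measurable_pair1 _)).
    + by apply: emeasurable_funD => //; apply: measurableT_comp.
    + move=> y _ /=; rewrite lee_fin (le_trans (fgh _ _))//.
      by rewrite lerD// ler_norm.
under eq_integral do rewrite EFinD.
rewrite ge0_integralD//; last 2 first.
- by apply/measurable_EFinP; exact: measurableT_comp.
- by move=> x _; rewrite lee_fin fine_ge0.
rewrite integral_cst// [X in (_ + _ * X)%E]probability_setT mule1 -cE lte_add_pinfty//.
by case/integrableP : ig.
Qed.

Lemma measurable_fun_Rintegral :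
  measurable_fun [set: T1] (fun x => \int[nu]_y f x y).
Proof.
apply: (measurableT_comp (fine_measurable measurableT)).
exact: (measurable_fubini_F integrable_product).
Qed.

Let isec x : nu.-integrable setT (EFin \o f x).
Proof.
apply: (@dominated_integrable _ _ nu setT (f x) (fun y => g x + h y));
  [by []|exact: (measurable_fun_pair2 x mf)| |by []].
rewrite /comp; under eq_fun do rewrite EFinD.
by apply: integrableD => //; exact: finite_measure_integrable_cst.
Qed.

Let isec' y : mu.-integrable setT (EFin \o f ^~ y).
Proof.
apply: (@dominated_integrable _ _ mu setT (f ^~ y) (fun x => g x + h y));
  [by []|exact: (measurable_fun_pair1 y mf)| |by []].
rewrite /comp; under eq_fun do rewrite EFinD.
by apply: integrableD => //; exact: finite_measure_integrable_cst.
Qed.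

Lemma Rintegral_product :
  \int[(mu \x nu)%E]_z f z.1 z.2 = \int[mu]_x \int[nu]_y f x y.
Proof.
congr fine; rewrite -(integral12_prod_meas1 integrable_product).
by apply: eq_integral => x _; rewrite fineK//; exact: integrable_fin_num (isec x).
Qed.

Lemma Rintegral_exchange :
  \int[mu]_x \int[nu]_y f x y = \int[nu]_y \int[mu]_x f x y.
Proof.
rewrite -Rintegral_product; congr fine.
rewrite -(integral21_prod_meas1 integrable_product).
by apply: eq_integral => y _; rewrite fineK//; exact: integrable_fin_num (isec' y).
Qed.

End fubini.

Section bounded_fubini.
Context d1 d2 (T1 : measurableType d1) (T2 : measurableType d2).
Variables (mu : probability T1 R) (nu : probability T2 R).
Variables (f : T1 -> T2 -> R) (C : R).
Hypothesis mf : measurable_fun [set: T1 * T2] (fun z => f z.1 z.2).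
Hypothesis fC : forall x y, `|f x y| <= C.

Let fC0 x y : `|f x y| <= cst C x + cst 0 y.
Proof. by rewrite /= addr0. Qed.

Lemma bounded_measurable_fun_Rintegral :
  measurable_fun [set: T1] (fun x => \int[nu]_y f x y).
Proof.
apply: (@measurable_fun_Rintegral _ _ T1 T2 mu nu f (cst C) (cst 0)) => //;
  exact: finite_measure_integrable_cst.
Qed.

Lemma bounded_Rintegral_product :
  \int[(mu \x nu)%E]_z f z.1 z.2 = \int[mu]_x \int[nu]_y f x y.
Proof.
by apply: (@Rintegral_product _ _ T1 T2 mu nu f (cst C) (cst 0)) => //;
  exact: finite_measure_integrable_cst.
Qed.

Lemma bounded_Rintegral_exchange :
  \int[mu]_x \int[nu]_y f x y = \int[nu]_y \int[mu]_x f x y.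
Proof.
by apply: (@Rintegral_exchange _ _ T1 T2 mu nu f (cst C) (cst 0)) => //;
  exact: finite_measure_integrable_cst.
Qed.

End bounded_fubini.

Section triple.
Variables (mu : probability borelR R) (f : R -> R -> R -> R) (C : R).
Hypothesis mf :
  measurable_fun [set: (borelR * borelR) * borelR] (fun z => f z.1.1 z.1.2 z.2).
Hypothesis fC : forall x y z, `|f x y z| <= C.

Lemma Rintegral_triple :
  \int[((mu \x mu) \x mu)%E]_z f z.1.1 z.1.2 z.2 =
  \int[mu]_a \int[mu]_b \int[mu]_c f a b c.
Proof.
rewrite (@bounded_Rintegral_product _ _ _ _ (mu \x mu)%E mu
  (fun z c => f z.1 z.2 c) C)//.
rewrite -(@bounded_Rintegral_product _ _ _ _ mu mu
  (fun a b => \int[mu]_c f a b c) C)//.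
- exact: (@bounded_measurable_fun_Rintegral _ _ _ _ (mu \x mu)%E mu
    (fun z c => f z.1 z.2 c) C).
- move=> a b; apply: Rintegral_bound => //.
  exact: (measurable_fun_pair2 (a, b) mf).
Qed.

(** A single Fubini exchange, between [a] and the pair [(b, c)] seen as one variable of the product
    space, realizes the cyclic permutation. *)
Lemma Rintegral_cycle :
  \int[mu]_a \int[mu]_b \int[mu]_c f b c a =
  \int[mu]_a \int[mu]_b \int[mu]_c f a b c.
Proof.
transitivity (\int[mu]_a \int[(mu \x mu)%E]_z f z.1 z.2 a).
  apply: eq_Rintegral => a _.
  rewrite (@bounded_Rintegral_product _ _ _ _ mu mu (fun b c => f b c a) C)//.
  exact: (measurable_fun_pair1 a mf).
rewrite -Rintegral_triple (@bounded_Rintegral_product _ _ _ _ (mu \x mu)%E mu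
  (fun z c => f z.1 z.2 c) C)//.
rewrite (@bounded_Rintegral_exchange _ _ _ _ mu (mu \x mu)%E
  (fun a z => f z.1 z.2 a) C)//.
have msw : measurable_fun setT
    (fun z : borelR * (borelR * borelR) => (z.2, z.1)).
  by apply: measurable_fun_pair; [exact: measurable_snd|exact: measurable_fst].
exact: (@measurableT_comp _ _ _ _ _ _ (fun z => f z.1.1 z.1.2 z.2) _ _ mf msw).
Qed.

End triple.

End integration.

(** * The conjugate Poisson kernel *)

Section kernel.
Context {R : realType}.
Local Notation borelR := (measurableTypeR R).
Implicit Types (e h x y a b c : R).

Definition conj_poisson e h : R := h / (h ^+ 2 + e ^+ 2).
Local Notation q := conj_poisson.

(* Junk value: [0] on the diagonal. *)
Definition diff_quot (psi : R -> R) x y : R := (psi x - psi y) / (x - y).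

Lemma conj_poisson_den e h : 0 < e -> 0 < h ^+ 2 + e ^+ 2.
Proof. by move=> e0; rewrite ltr_wpDl ?sqr_ge0 ?exprn_gt0. Qed.

Lemma conj_poissonN e h : q e (- h) = - q e h.
Proof. by rewrite /q sqrrN mulNr. Qed.

Lemma conj_poisson_bound e h : 0 < e -> `|q e h| <= e^-1.
Proof.
move=> e0; have d0 := conj_poisson_den h e0.
rewrite normrM normfV (gtr0_norm d0) ler_pdivrMr// [leRHS]mulrC ler_pdivlMr//.
by rewrite -(real_normK (num_real h)); have := normr_ge0 h; nra.
Qed.

(** The bound is uniform in [e], which is what dominated convergence needs as [e -> 0]. At [h = 0]
    both sides vanish, since [0^-1 = 0]. *)
Lemma conj_poisson_le_inv e h : 0 < e -> `|q e h| <= `|h|^-1.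
Proof.
move=> e0; have d0 := conj_poisson_den h e0.
have [->|h0] := eqVneq h 0; first by rewrite /q mul0r normr0 invr0.
rewrite normrM normfV (gtr0_norm d0) ler_pdivrMr// [leRHS]mulrC ler_pdivlMr ?normr_gt0//.
by rewrite -(real_normK (num_real h)); have := normr_ge0 h; nra.
Qed.

Lemma conj_poisson_sub e a b : 0 < e ->
  q e a - q e b = (a - b) *
    ((e ^+ 2 - a * b) / ((a ^+ 2 + e ^+ 2) * (b ^+ 2 + e ^+ 2))).
Proof.
move=> e0; rewrite /q; field.
by rewrite !gt_eqF// conj_poisson_den.
Qed.

(** The slope given by [conj_poisson_sub] is largest in absolute value at [a = b = 0], where it is
    [e^-2]. *)
Lemma conj_poisson_lipschitz e a b : 0 < e ->
  `|q e a - q e b| <= e ^- 2 * `|a - b|.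
Proof.
move=> e0; rewrite conj_poisson_sub// normrM mulrC ler_wpM2r//.
have da := conj_poisson_den a e0; have db := conj_poisson_den b e0.
rewrite normrM normfV [`|(_ + _) * _|]gtr0_norm ?mulr_gt0//.
rewrite ler_pdivrMr ?mulr_gt0// [leRHS]mulrC ler_pdivlMr ?exprn_gt0//.
have e20 : 0 < e ^+ 2 by rewrite exprn_gt0.
have h1 : `|e ^+ 2 - a * b| <= e ^+ 2 + `|a| * `|b|.
  by have := ler_normB (e ^+ 2) (a * b); rewrite (normrM a b) (gtr0_norm e20).
apply: (le_trans (ler_wpM2r (ltW e20) h1)).
rewrite -(real_normK (num_real a)) -(real_normK (num_real b)).
have ha := normr_ge0 a; have hb := normr_ge0 b.
have := sqr_ge0 (`|a| - `|b|).
have : 0 <= `|a| * `|b| by rewrite mulr_ge0.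
set x := `|a|; set y := `|b|; set s := e ^+ 2 => xy0 xy1.
rewrite -subr_ge0.
have -> : (x ^+ 2 + s) * (y ^+ 2 + s) - (s + x * y) * s =
   (x * y) ^+ 2 + s * (x - y) ^+ 2 + s * (x * y) by ring.
have s0 : 0 <= s by exact: ltW.
by rewrite !addr_ge0 ?sqr_ge0 ?(mulr_ge0 s0) ?sqr_ge0.
Qed.

Lemma continuous_conj_poisson e : 0 < e -> continuous (q e).
Proof.
move=> e0 h; rewrite /q; apply: cvgM; first exact: cvg_id.
apply: cvgV; first by rewrite gt_eqF// conj_poisson_den.
by apply: cvgD; [apply: cvgM; exact: cvg_id|exact: cvg_cst].
Qed.

Lemma measurable_conj_poisson e : 0 < e -> measurable_fun setT (q e).
Proof. by move=> e0; apply: continuous_measurable_fun; exact: continuous_conj_poisson. Qed.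

(** The convergence holds at [h = 0] too, the limit there being the junk value [0^-1 = 0]; no
    diagonal has to be removed from the integrals. *)
Lemma cvg_conj_poisson (e_ : nat -> R) h :
  e_ n @[n --> \oo] --> 0 -> q (e_ n) h @[n --> \oo] --> h^-1.
Proof.
move=> e_0; have [->|h0] := eqVneq h 0.
  by rewrite invr0 /q; under eq_fun do rewrite mul0r; exact: cvg_cst.
have -> : h^-1 = h / (h ^+ 2 + 0 ^+ 2).
  by rewrite expr0n addr0 expr2 invfM mulrA divff// mul1r.
apply: cvgM; first exact: cvg_cst.
apply: cvgV; first by rewrite expr0n addr0 sqrf_eq0.
by apply: cvgD; [exact: cvg_cst|apply: cvgM].
Qed.

(* For distinct points the difference of the two sides is
   [3 e^4 / ((x^2 + e^2) (y^2 + e^2) ((x - y)^2 + e^2))]. *)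
Let cycle_ineq e x y : 0 < e ->
  q e (x - y) * q e x - q e y * q e (x - y) + q e x * q e y <=
  (q e x - q e y) / (x - y) + (q e x - q e (x - y)) / y
   + (q e y + q e (x - y)) / x.
Proof.
move=> e0; have s0 : 0 < e ^+ 2 by rewrite exprn_gt0.
have d h := conj_poisson_den h e0.
have q0 : q e 0 = 0 by rewrite /q mul0r.
have qq h : h != 0 -> q e h / h = (h ^+ 2 + e ^+ 2)^-1.
  by move=> h0; rewrite /q mulrAC divff// mul1r.
(* For the case of two coinciding points: one difference quotient takes its junk value [0], the
   other two add up to [2 / (h^2 + e^2)], and this still exceeds the one product left on the other
   side. *)
have qle h : q e h * q e h <= 2 * (h ^+ 2 + e ^+ 2)^-1.
  rewrite /q -subr_ge0.
  have -> : 2 * (h ^+ 2 + e ^+ 2)^-1 -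
    h / (h ^+ 2 + e ^+ 2) * (h / (h ^+ 2 + e ^+ 2)) =
    (h ^+ 2 + e ^+ 2 * 2) / (h ^+ 2 + e ^+ 2) ^+ 2.
    by field; rewrite gt_eqF.
  by rewrite divr_ge0 ?sqr_ge0// addr_ge0 ?sqr_ge0// mulr_ge0// ltW.
have [->|x0] := eqVneq x 0.
  rewrite sub0r q0 invr0 !(mulr0, mul0r, add0r, addr0, conj_poissonN, opprK, mulrN, mulNr, sub0r).
  rewrite invrN mulrN opprK.
  have [->|y0] := eqVneq y 0; first by rewrite q0 !(mulr0, mul0r) addr0.
  by rewrite qq//; have := qle y; lra.
have [->|y0] := eqVneq y 0.
  rewrite subr0 q0 invr0 !(mulr0, mul0r, add0r, addr0, subr0).
  by rewrite qq//; have := qle x; lra.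
have [->|xy] := eqVneq x y.
  rewrite subrr q0 invr0 !(mulr0, mul0r, add0r, addr0, subr0).
  by rewrite qq//; have := qle y; lra.
have xy0 : x - y != 0 by rewrite subr_eq0.
rewrite -subr_ge0.
have -> : (q e x - q e y) / (x - y) + (q e x - q e (x - y)) / y
   + (q e y + q e (x - y)) / x -
  (q e (x - y) * q e x - q e y * q e (x - y) + q e x * q e y) =
  3 * (e ^+ 2) ^+ 2 /
   ((x ^+ 2 + e ^+ 2) * (y ^+ 2 + e ^+ 2) * ((x - y) ^+ 2 + e ^+ 2)).
  by rewrite /q; field; rewrite x0 y0 xy0 !gt_eqF.
by rewrite divr_ge0 ?mulr_ge0 ?sqr_ge0// ltW.
Qed.

(** Translation reduces this to [cycle_ineq] with [x = a - c] and [y = b - c]. The inequality fails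
    term by term: for [a] close to [b] and far from [c] the first quotient is negative while the
    first product is nearly zero. *)
Lemma conj_poisson_cycle e a b c : 0 < e ->
  q e (a - b) * q e (a - c) + q e (b - c) * q e (b - a)
    + q e (c - a) * q e (c - b) <=
  diff_quot (fun x => q e (x - c)) a b + diff_quot (fun x => q e (x - a)) b c
    + diff_quot (fun x => q e (x - b)) c a.
Proof.
move=> e0; rewrite /diff_quot.
have := cycle_ineq (a - c) (b - c) e0.
have -> : a - c - (b - c) = a - b by ring.
rewrite -(opprB a b) -(opprB a c) -(opprB b c) !conj_poissonN.
rewrite !(invrN, mulrN, mulNr, opprK, opprD).
by move=> h; lra.
Qed.

Lemma diff_quot_bound (psi : R -> R) (L : R) x y : 0 <= L ->
  `|psi x - psi y| <= L * `|x - y| -> `|diff_quot psi x y| <= L.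
Proof.
move=> L0 h; rewrite /diff_quot normrM normfV.
have [->|xy] := eqVneq x y; first by rewrite subrr normr0 mul0r.
by rewrite ler_pdivrMr// normr_gt0 subr_eq0.
Qed.

(** Inversion is discontinuous at [0], but it is the pointwise limit of continuous kernels. *)
Lemma measurable_inv : measurable_fun setT (@GRing.inv R).
Proof.
apply: (@measurable_fun_cvg _ _ _ _ (fun n => q (harmonic n))).
  by move=> n; exact: measurable_conj_poisson (harmonic_gt0 n).
by move=> h _; apply: cvg_conj_poisson; exact: cvg_harmonic.
Qed.

Lemma measurable_diff_quot (psi : R -> R) : measurable_fun setT psi ->
  measurable_fun [set: borelR * borelR] (fun z => diff_quot psi z.1 z.2).
Proof.
move=> mpsi; apply: measurable_funM.
  by apply: measurable_funB; exact: measurableT_comp.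
apply: (measurableT_comp measurable_inv).
by apply: measurable_funB.
Qed.

(** The symmetrized form of [\int psi H dmu]: unlike that integral it makes sense for every
    Lipschitz [psi] and every [mu]. On the diagonal the quotient is [0] and not the derivative of
    [psi], which is invisible as soon as [mu] has a density. *)
Definition pair_form (mu : probability borelR R) (psi : R -> R) : R :=
  2^-1 * \int[mu]_x \int[mu]_y diff_quot psi x y.

Definition smooth_hilbert e (mu : probability borelR R) x : R :=
  \int[mu]_y q e (x - y).

Section regularized.
Variables (mu : probability borelR R) (e : R).
Hypothesis e0 : 0 < e.
Local Notation H := (smooth_hilbert e mu).

Lemma measurable_conj_poisson_sub2 :
  measurable_fun [set: borelR * borelR] (fun z => q e (z.1 - z.2)).
Proof.
apply: (measurableT_comp (measurable_conj_poisson e0)).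
exact: measurable_funB.
Qed.

Lemma measurable_conj_poisson_sub x :
  measurable_fun [set: borelR] (fun y => q e (x - y)).
Proof. exact: (measurable_fun_pair2 x measurable_conj_poisson_sub2). Qed.

Lemma conj_poisson_sub_integrable x :
  mu.-integrable setT (EFin \o (fun y => q e (x - y))).
Proof.
apply: (@bounded_integrable _ _ _ mu _ e^-1); first exact: measurable_conj_poisson_sub.
by move=> y; exact: conj_poisson_bound.
Qed.

Lemma measurable_smooth_hilbert : measurable_fun setT H.
Proof.
apply: (@bounded_measurable_fun_Rintegral _ _ _ _ _ mu mu _ e^-1).
  exact: measurable_conj_poisson_sub2.
by move=> *; exact: conj_poisson_bound.
Qed.

Lemma smooth_hilbert_bound x : `|H x| <= e^-1.
Proof.
apply: Rintegral_bound; first exact: measurable_conj_poisson_sub.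
by move=> *; exact: conj_poisson_bound.
Qed.

Lemma diff_quot_smooth_hilbert a b :
  diff_quot H a b = \int[mu]_c diff_quot (fun x => q e (x - c)) a b.
Proof.
have qi x := conj_poisson_sub_integrable x.
rewrite /diff_quot RintegralZr//; last first.
  rewrite /comp; under eq_fun do rewrite EFinB.
  by apply: integrableB; [|exact: qi|exact: qi].
by rewrite RintegralB.
Qed.

Lemma smooth_hilbert_lipschitz x y : `|H x - H y| <= e ^- 2 * `|x - y|.
Proof.
rewrite /smooth_hilbert -RintegralB//; try exact: conj_poisson_sub_integrable.
apply: Rintegral_bound.
  by apply: measurable_funB; exact: measurable_conj_poisson_sub.
move=> c; apply: le_trans (conj_poisson_lipschitz _ _ e0) _.
by have -> : x - c - (y - c) = x - y by ring.
Qed.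

(** [Q] and [K] are the triple integrands of the two sides. They compare pointwise only after
    summation over the three cyclic permutations of the variables, which all have the same
    integral. *)
Lemma pair_form_smooth_hilbert_ge :
  \int[mu]_x H x ^+ 2 <= 2 * pair_form mu H.
Proof.
have e20 : 0 <= e ^- 2 by rewrite invr_ge0 exprn_ge0 ?ltW.
pose K a b c := diff_quot (fun x => q e (x - c)) a b.
pose Q a b c := q e (a - b) * q e (a - c).
have KC a b c : `|K a b c| <= e ^- 2.
  apply: diff_quot_bound => //.
  apply: le_trans (conj_poisson_lipschitz _ _ e0) _.
  by have -> : a - c - (b - c) = a - b by ring.
have QC a b c : `|Q a b c| <= e ^- 2.
  by rewrite normrM -exprVn expr2; apply: ler_pM => //; exact: conj_poisson_bound.
have m1 : measurable_fun [set: (borelR * borelR) * borelR] (fun z => z.1.1).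
  exact: measurableT_comp.
have m2 : measurable_fun [set: (borelR * borelR) * borelR] (fun z => z.1.2).
  exact: measurableT_comp.
have mq (f g : (borelR * borelR) * borelR -> borelR) : measurable_fun setT f ->
    measurable_fun setT g -> measurable_fun setT (fun z => q e (f z - g z)).
  move=> mf mg; apply: (measurableT_comp (measurable_conj_poisson e0)).
  exact: measurable_funB.
have mK : measurable_fun [set: (borelR * borelR) * borelR]
    (fun z => K z.1.1 z.1.2 z.2).
  apply: measurable_funM; first by apply: measurable_funB; exact: mq.
  by apply: (measurableT_comp measurable_inv); exact: measurable_funB.
have mQ : measurable_fun [set: (borelR * borelR) * borelR]
    (fun z => Q z.1.1 z.1.2 z.2).
  by apply: measurable_funM; exact: mq.
have permm (f : R -> R -> R -> R) :
    measurable_fun [set: (borelR * borelR) * borelR] (fun z => f z.1.1 z.1.2 z.2) ->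
    measurable_fun [set: (borelR * borelR) * borelR] (fun z => f z.1.2 z.2 z.1.1).
  move=> mf; have msw : measurable_fun setT
      (fun z : (borelR * borelR) * borelR => ((z.1.2, z.2), z.1.1)).
    by do 2 (apply: measurable_fun_pair => //).
  exact: (@measurableT_comp _ _ _ _ _ _ (fun z => f z.1.1 z.1.2 z.2) _ _ mf msw).
have -> : \int[mu]_x H x ^+ 2 =
    \int[mu]_a \int[mu]_b \int[mu]_c Q a b c.
  apply: eq_Rintegral => a _; rewrite expr2 -RintegralZr//.
    apply: eq_Rintegral => b _; rewrite -RintegralZl//.
    exact: conj_poisson_sub_integrable.
  exact: conj_poisson_sub_integrable.
have -> : 2 * pair_form mu H = \int[mu]_a \int[mu]_b \int[mu]_c K a b c.
  rewrite mulrA divff// mul1r; apply: eq_Rintegral => a _.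
  by apply: eq_Rintegral => b _; rewrite diff_quot_smooth_hilbert.
have bi (f : R -> R -> R -> R) :
    measurable_fun [set: (borelR * borelR) * borelR] (fun z => f z.1.1 z.1.2 z.2) ->
    (forall a b c, `|f a b c| <= e ^- 2) ->
    ((mu \x mu) \x mu)%E.-integrable setT (EFin \o (fun z => f z.1.1 z.1.2 z.2)).
  by move=> mf fC; apply: (@bounded_integrable _ _ _ ((mu \x mu) \x mu)%E _ (e ^- 2)).
(* The three permuted iterated integrals agree, so three times one of them is a single integral over
   the product space, where monotonicity of the integral applies. *)
have sum3 (f : R -> R -> R -> R) :
    measurable_fun [set: (borelR * borelR) * borelR] (fun z => f z.1.1 z.1.2 z.2) ->
    (forall a b c, `|f a b c| <= e ^- 2) ->
    ((mu \x mu) \x mu)%E.-integrable setT (EFin \o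
      (fun z => f z.1.1 z.1.2 z.2 + f z.1.2 z.2 z.1.1 + f z.2 z.1.1 z.1.2)) /\
    3 * \int[mu]_a \int[mu]_b \int[mu]_c f a b c =
    \int[((mu \x mu) \x mu)%E]_z
      (f z.1.1 z.1.2 z.2 + f z.1.2 z.2 z.1.1 + f z.2 z.1.1 z.1.2).
  move=> mf fC.
  have mf1 := permm _ mf; have mf2 := permm (fun a b c => f b c a) mf1.
  have if0 := bi _ mf fC.
  have if1 := bi (fun a b c => f b c a) mf1 (fun a b c => fC b c a).
  have if2 := bi (fun a b c => f c a b) mf2 (fun a b c => fC c a b).
  have if01 : ((mu \x mu) \x mu)%E.-integrable setT (EFin \o
      (fun z => f z.1.1 z.1.2 z.2 + f z.1.2 z.2 z.1.1)).
    by rewrite /comp; under eq_fun do rewrite EFinD; exact: integrableD if0 if1.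
  split.
    by rewrite /comp; under eq_fun do rewrite EFinD; exact: integrableD if01 if2.
  rewrite (RintegralD _ if01 if2)// (RintegralD _ if0 if1)//.
  have t0 := Rintegral_triple mu mf fC.
  have t1 := @Rintegral_triple _ mu (fun a b c => f b c a) _ mf1 (fun a b c => fC b c a).
  have t2 := @Rintegral_triple _ mu (fun a b c => f c a b) _ mf2 (fun a b c => fC c a b).
  have c1 := Rintegral_cycle mu mf fC.
  have c2 := @Rintegral_cycle _ mu (fun a b c => f b c a) _ mf1 (fun a b c => fC b c a).
  transitivity (\int[mu]_a \int[mu]_b \int[mu]_c f a b c
    + \int[mu]_a \int[mu]_b \int[mu]_c f a b c
    + \int[mu]_a \int[mu]_b \int[mu]_c f a b c); first by ring.
  congr (_ + _ + _).
  - exact: esym t0.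
  - exact: esym (etrans t1 c1).
  - exact: esym (etrans t2 (etrans c2 c1)).
have [iK eK] := sum3 K mK KC.
have [iQ eQ] := sum3 Q mQ QC.
suff h : 3 * \int[mu]_a \int[mu]_b \int[mu]_c Q a b c <=
    3 * \int[mu]_a \int[mu]_b \int[mu]_c K a b c by move: h; rewrite ler_pM2l.
rewrite [leLHS]eQ [leRHS]eK.
apply: le_Rintegral => //.
by move=> [[a b] c] _ /=; exact: conj_poisson_cycle.
Qed.

End regularized.
End kernel.

(** * Principal values *)

(** Bundled below as a measurable map, so that the pushforward of Lebesgue measure under it is a
    measure to which the uniqueness theorem applies. *)
Definition reflect_at {R : realType} (c : measurableTypeR R) :
  measurableTypeR R -> measurableTypeR R := fun y => c - y.

Lemma measurable_reflect_at {R : realType} (c : measurableTypeR R) :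
  measurable_fun setT (reflect_at c).
Proof. by apply: measurable_funB. Qed.

HB.instance Definition _ (R : realType) (c : measurableTypeR R) :=
  isMeasurableFun.Build _ _ _ _ (reflect_at c) (measurable_reflect_at c).

Section principal_value.
Context {R : realType}.
Local Notation borelR := (measurableTypeR R).
Local Notation leb := (@lebesgue_measure R).
Local Notation q := (@conj_poisson R).

Lemma lebesgue_measure_reflect (c : R) (A : set borelR) : measurable A ->
  pushforward leb (reflect_at c) A = leb A.
Proof.
move=> mA; apply/esym/lebesgue_measure_unique => //= _ [[a b]] _ <-.
(* The preimage of []a, b]] is half-open on the other side; only its length matters. *)
rewrite /pushforward/= [X in _ = lebesgue_measure X](_ : _ = `[c - b, c - a[%classic).
  rewrite !lebesgue_measure_itv/= !lte_fin ltrD2l ltrN2.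
  by rewrite -!EFinB; have -> : c - a - (c - b) = b - a by ring.
by apply/seteqP; split => y /=; rewrite /reflect_at !in_itv/= => /andP[h1 h2]; apply/andP; split; lra.
Qed.

(** The map [y |-> c - y] reflects about [c / 2]. With [c = 2 * x] this cancels the integral of an
    odd kernel centred at [x]. *)
Lemma Rintegral_reflect_odd (c : R) (f : R -> R) :
  leb.-integrable setT (EFin \o f) -> (forall y, f (c - y) = - f y) ->
  \int[leb]_y f y = 0.
Proof.
move=> fi fodd.
have mf : measurable_fun setT (EFin \o f) by exact: measurable_int fi.
have fphi : (EFin \o f) \o reflect_at c = EFin \o (fun y => - f y).
  by apply/funext => y /=; rewrite /reflect_at fodd.
have e : \int[leb]_y f y = \int[leb]_y - f y.
  congr fine.
  transitivity (\int[pushforward leb (reflect_at c)]_y (f y)%:E)%E.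
    apply: eq_measure_integral => A mA _; apply/esym.
    exact: lebesgue_measure_reflect.
  rewrite (@integral_pushforward _ _ borelR borelR R _ (measurable_reflect_at c)
    leb setT (EFin \o f))//.
    by apply: eq_integral => y _ /=; rewrite /reflect_at fodd.
  rewrite preimage_setT fphi.
  by rewrite /comp; under eq_fun do rewrite EFinN; exact: integrableN.
have : \int[leb]_y - f y = - \int[leb]_y f y.
  under eq_Rintegral do rewrite -mulN1r.
  by rewrite RintegralZl// mulN1r.
by rewrite -e; move: (Rintegral _ _ _) => t h; lra.
Qed.

Variables (mu : probability borelR R) (v : R -> R).
Hypothesis mv : measurable_fun setT v.
Hypothesis muv : has_density mu v.

Local Notation I x := (`[x - 1, x + 1]%classic : set R).

(** The value [v x] is subtracted on the unit window only: there the Lipschitz bound on [v] cancels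
    the singularity of [r], while subtracting it on the whole line would spoil integrability at
    infinity. *)
Definition pv_integrand (r : R -> R) (x y : R) : R :=
  r (x - y) * (v y - v x * \1_(I x) y).

Let in_I (x y : R) : (y \in I x) = (`|x - y| <= 1).
Proof.
apply/idP/idP; first by rewrite inE/= in_itv/= ler_norml => ?; lra.
by move=> h; rewrite inE/= in_itv/=; move: h; rewrite ler_norml; lra.
Qed.

Let m1I (x : R) : measurable_fun setT (\1_(I x) : R -> R).
Proof. exact: measurable_indic. Qed.

Let i1I (x : R) : leb.-integrable setT (EFin \o \1_(I x)).
Proof. exact: integrable_indic_itv. Qed.

Section kernel.
Variable (r : R -> R).
Hypothesis mr : measurable_fun setT r.
Hypothesis rinv : forall h, `|r h| <= `|h|^-1.

Let mrx (x : R) : measurable_fun setT (fun y : R => r (x - y)).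
Proof. by apply: (measurableT_comp mr); apply: measurable_funB. Qed.

Lemma measurable_pv_integrand (x : R) : measurable_fun setT (pv_integrand r x).
Proof.
by apply: measurable_funM => //; apply: measurable_funB => //; exact: measurable_funM.
Qed.

Lemma pv_integrand_bound (x L y : R) : 0 <= L ->
  (forall y, `|x - y| <= 1 -> `|v x - v y| <= L * `|x - y|) ->
  `|pv_integrand r x y| <= L * \1_(I x) y + v y.
Proof.
move=> L0 vL; have v0 := muv.1 y; rewrite /pv_integrand normrM indicE in_I.
have [h|h] := leP `|x - y| 1.
  rewrite !mulr1; apply: (@le_trans _ _ L); last by rewrite lerDl.
  have [xy|xy] := eqVneq x y; first by rewrite xy (subrr (v y)) normr0 mulr0.
  have xy0 : 0 < `|x - y| by rewrite normr_gt0 subr_eq0.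
  have vxy : `|v y - v x| <= L * `|x - y|.
    by rewrite [leLHS]distrC; exact: vL.
  apply: (@le_trans _ _ (`|x - y|^-1 * (L * `|x - y|))).
    by apply: ler_pM => //; exact: rinv.
  by rewrite mulrCA mulVf ?mulr1// gt_eqF.
rewrite !mulr0 subr0 add0r (ger0_norm v0) -[leRHS]mul1r ler_wpM2r//.
by rewrite (le_trans (rinv _))// invf_le1// ?ltW// (lt_trans _ h).
Qed.

Lemma pv_dominator_integrable (x L : R) :
  leb.-integrable setT (EFin \o (fun y => L * \1_(I x) y + v y)).
Proof.
rewrite /comp; under eq_fun do rewrite EFinD EFinM.
apply: integrableD => //; last exact: integrable_density1 mv muv.
(apply: integrableZl; [by []|exact: i1I]).
Qed.

Lemma pv_integrand_integrable (x L : R) : 0 <= L ->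
  (forall y, `|x - y| <= 1 -> `|v x - v y| <= L * `|x - y|) ->
  leb.-integrable setT (EFin \o pv_integrand r x).
Proof.
move=> L0 vL; apply: (@dominated_integrable _ _ _ leb setT _
  (fun y => L * \1_(I x) y + v y)) => //.
- exact: measurable_pv_integrand.
- exact: pv_dominator_integrable.
- by move=> y _; exact: pv_integrand_bound.
Qed.

Lemma Rintegral_density1 : \int[leb]_x v x = 1.
Proof.
rewrite -[RHS](Rintegral_probability_cst mu) (Rintegral_density mv muv)//.
by under [RHS]eq_Rintegral do rewrite mul1r.
Qed.

(** The window has length [2], which gives [2 * L]; outside it [|r| <= 1], and the mass of [v] gives
    the [1]. *)
Lemma pv_integral_bound (x L : R) : 0 <= L ->
  (forall y, `|x - y| <= 1 -> `|v x - v y| <= L * `|x - y|) ->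
  `|\int[leb]_y pv_integrand r x y| <= 2 * L + 1.
Proof.
move=> L0 vL; have pi := pv_integrand_integrable L0 vL.
apply: le_trans (le_normr_Rintegral measurableT pi) _.
apply: (@le_trans _ _ (\int[leb]_y (L * \1_(I x) y + v y))).
  apply: le_Rintegral => //; first exact: integrable_norm.
    exact: pv_dominator_integrable.
  by move=> y _; exact: pv_integrand_bound.
rewrite RintegralD//; last 2 first.
- by rewrite /comp; under eq_fun do rewrite EFinM; (apply: integrableZl; [by []|exact: i1I]).
- exact: integrable_density1 mv muv.
rewrite RintegralZl// Rintegral_density1 lerD2r mulrC ler_wpM2r//.
rewrite /Rintegral integral_indic// setIT [X in fine X]lebesgue_measure_itv/= lte_fin.
by rewrite ltrD2l gtrN// -EFinB/=; lra.
Qed.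

(** The subtracted term is odd about [x] and integrates to zero. The bound [B], which [GRing.inv]
    lacks, makes the two terms separately integrable. *)
Lemma Rintegral_pv (x L B : R) : 0 <= L ->
  (forall y, `|x - y| <= 1 -> `|v x - v y| <= L * `|x - y|) ->
  (forall h, `|r h| <= B) -> (forall h, r (- h) = - r h) ->
  \int[mu]_y r (x - y) = \int[leb]_y pv_integrand r x y.
Proof.
move=> L0 vL rB rodd; rewrite (Rintegral_density mv muv (mrx x)).
have i1 : leb.-integrable setT (EFin \o (fun y => r (x - y) * v y)).
  apply/(integrable_density mv muv (mrx x)).
  by apply: (@bounded_integrable _ _ _ mu _ B) => //; exact: mrx.
have i2 : leb.-integrable setT (EFin \o (fun y => r (x - y) * \1_(I x) y)).
  apply: (@dominated_integrable _ _ _ leb setT _ (fun y => B * \1_(I x) y)) => //.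
  - by apply: measurable_funM; [exact: mrx|exact: m1I].
  - by rewrite /comp; under eq_fun do rewrite EFinM; (apply: integrableZl; [by []|exact: i1I]).
  - by move=> y _; rewrite normrM [`|\1_(I x) y|]ger0_norm// ler_wpM2r.
have z : \int[leb]_y (r (x - y) * \1_(I x) y) = 0.
  apply: (@Rintegral_reflect_odd (2 * x)) => // y.
  rewrite !indicE !in_I.
  have -> : x - (2 * x - y) = - (x - y) by ring.
  by rewrite rodd normrN mulNr.
have i3 : leb.-integrable setT
    (EFin \o (fun y => v x * (r (x - y) * \1_(I x) y))).
  by rewrite /comp; under eq_fun do rewrite EFinM; (apply: integrableZl; [by []|exact: i2]).
rewrite -[LHS]subr0 -(mulr0 (v x)) -z -RintegralZl// -RintegralB//.
by apply: eq_Rintegral => y _; rewrite /pv_integrand; ring.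
Qed.

End kernel.

(** Stated for arbitrary odd kernels under [1 / |h|], to serve both the sharp truncations in
    [hilbert] and the kernels [conj_poisson], which therefore share their limit. *)
Lemma cvg_pv (x L : R) (r_ : nat -> R -> R) : 0 <= L ->
  (forall y, `|x - y| <= 1 -> `|v x - v y| <= L * `|x - y|) ->
  (forall n, measurable_fun setT (r_ n)) ->
  (forall n h, `|r_ n h| <= `|h|^-1) ->
  (forall n, exists B, forall h, `|r_ n h| <= B) ->
  (forall n h, r_ n (- h) = - r_ n h) ->
  (forall h, r_ n h @[n --> \oo] --> h^-1) ->
  \int[mu]_y r_ n (x - y) @[n --> \oo] -->
    \int[leb]_y pv_integrand GRing.inv x y.
Proof.
move=> L0 vL mr rinv rB rodd rcvg.
under eq_fun => n.
  have [B rnB] := rB n.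
  rewrite (Rintegral_pv (mr n) L0 vL rnB (rodd n)).
  over.
have [|||_ cp] := @Rdominated_convergence _ _ _ leb setT
  (fun n => pv_integrand (r_ n) x) (pv_integrand GRing.inv x)
  (fun y => L * \1_(I x) y + v y) measurableT
  (fun n => measurable_pv_integrand (mr n) x).
- exact: pv_dominator_integrable.
- by move=> n y _; exact: pv_integrand_bound.
- by move=> y _; apply: cvgMl; exact: rcvg.
exact: cp.
Qed.

(** [hilbert] is a [lim], meaningful only once convergence is known. Along any sequence [u n]
    decreasing to or merely tending to [0] from the right, the kernel truncated at [u n] is odd and
    bounded by [1 / u n], so [cvg_pv] applies. *)
Lemma hilbertE (x L : R) : 0 <= L ->
  (forall y, `|x - y| <= 1 -> `|v x - v y| <= L * `|x - y|) ->
  hilbert mu x = \int[leb]_y pv_integrand GRing.inv x y.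
Proof.
move=> L0 vL; apply: cvg_lim => //.
apply/cvg_at_rightP => u [u0 u_0].
pose r n h : R := (GRing.inv \_ [set h | u n < `|h|]) h.
have mset n : measurable [set h : borelR | u n < `|h|].
  rewrite [X in measurable X](_ : _ = Num.norm @^-1` `]u n, +oo[).
    by rewrite -[X in measurable X]setTI; by apply: normr_measurable.
  by apply/seteqP; split => h /=; rewrite in_itv/= andbT.
have := @cvg_pv x L r L0 vL.
have -> : (fun n => \int[mu]_(y in [set y | u n < `|x - y|]) (x - y)^-1) =
    (fun n => \int[mu]_y r n (x - y)).
  apply/funext => n; rewrite Rintegral_mkcond; apply: eq_Rintegral => y _.
  by rewrite /r !patchE; congr (if _ then _ else _); apply/idP/idP; rewrite !inE.
apply.
- move=> n; have mi : measurable_fun [set h : borelR | u n < `|h|] (@GRing.inv R).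
    exact: measurable_funTS measurable_inv.
  exact: (measurable_restrictT _ (mset n)).1 mi.
- by move=> n h; rewrite /r patchE; case: ifPn => _; rewrite ?normfV// normr0 invr_ge0.
- move=> n; exists (u n)^-1 => h; rewrite /r patchE; case: ifPn => [|_].
    rewrite inE/= => uh; rewrite normfV lef_pV2 ?posrE//; first exact: ltW.
    exact: lt_trans uh.
  by rewrite normr0 invr_ge0 ltW.
- move=> n h; rewrite /r !patchE.
  have -> : (- h \in [set h | u n < `|h|]) = (h \in [set h | u n < `|h|]).
    by apply/idP/idP; rewrite !inE/= normrN.
  by case: ifPn => _; rewrite ?invrN ?oppr0.
- move=> h; have [->|h0] := eqVneq h 0.
    rewrite invr0 [X in X @ _ --> _](_ : _ = cst 0); first exact: cvg_cst.
    by apply/funext => n; rewrite /r patchE; case: ifPn => // _; rewrite invr0.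
  apply: cvg_near_cst; have : 0 < `|h| by rewrite normr_gt0.
  move=> h0'; near=> n; rewrite /r patchE ifT// inE/=.
  near: n; move/cvgrPdist_lt : u_0 => /(_ _ h0'); apply: filterS => n.
  by rewrite sub0r normrN gtr0_norm.
Unshelve. all: by end_near. Qed.

Lemma cvg_smooth_hilbert (x L : R) : 0 <= L ->
  (forall y, `|x - y| <= 1 -> `|v x - v y| <= L * `|x - y|) ->
  smooth_hilbert (harmonic n) mu x @[n --> \oo] --> hilbert mu x.
Proof.
move=> L0 vL; rewrite (hilbertE L0 vL).
apply: (@cvg_pv x L (fun n => q (harmonic n))) => //.
- by move=> n; exact: measurable_conj_poisson (harmonic_gt0 n).
- by move=> n h; exact: conj_poisson_le_inv (harmonic_gt0 n).
- by move=> n; exists (harmonic n)^-1 => h; exact: conj_poisson_bound (harmonic_gt0 n).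
- by move=> n h; exact: conj_poissonN.
- by move=> h; apply: cvg_conj_poisson; exact: cvg_harmonic.
Qed.

Lemma smooth_hilbert_local_bound (e x L : R) : 0 < e -> 0 <= L ->
  (forall y, `|x - y| <= 1 -> `|v x - v y| <= L * `|x - y|) ->
  `|smooth_hilbert e mu x| <= 2 * L + 1.
Proof.
move=> e0 L0 vL; rewrite /smooth_hilbert.
have mq := measurable_conj_poisson e0.
have qi h := conj_poisson_le_inv h e0.
rewrite (Rintegral_pv mq L0 vL (fun h => conj_poisson_bound h e0)
  (conj_poissonN e)).
exact: pv_integral_bound.
Qed.

End principal_value.

(** * The flux as a symmetric double integral *)

Section weak_hilbert.
Context {R : realType}.
Local Notation borelR := (measurableTypeR R).
Local Notation leb := (@lebesgue_measure R).
Local Notation q := (@conj_poisson R).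

Lemma lipschitz_continuous (psi : R -> R) (M : R) :
  (forall x y, `|psi x - psi y| <= M * `|x - y|) -> continuous psi.
Proof.
move=> psiM x; apply/cvgrPdist_le => e e0.
have M0 : 0 < `|M| + 1 by rewrite ltr_pwDr.
have d0 : 0 < e / (`|M| + 1) by rewrite divr_gt0.
near=> y; apply: le_trans (psiM x y) _.
apply: (@le_trans _ _ ((`|M| + 1) * `|x - y|)).
  by rewrite ler_wpM2r// (le_trans (ler_norm M))// lerDl.
rewrite mulrC -ler_pdivlMr//; near: y.
Unshelve. all: by end_near. Qed.

Lemma lipschitz_measurable (psi : R -> R) (M : R) :
  (forall x y, `|psi x - psi y| <= M * `|x - y|) -> measurable_fun setT psi.
Proof.
by move=> psiM; apply: continuous_measurable_fun; exact: lipschitz_continuous psiM.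
Qed.

Lemma cvg_double_integral (mu : probability borelR R)
    (f_ : nat -> R -> R -> R) (f : R -> R -> R) (C : R) :
  (forall n, measurable_fun [set: borelR * borelR] (fun z => f_ n z.1 z.2)) ->
  (forall n x y, `|f_ n x y| <= C) ->
  (forall x y, f_ n x y @[n --> \oo] --> f x y) ->
  \int[mu]_x \int[mu]_y f_ n x y @[n --> \oo] --> \int[mu]_x \int[mu]_y f x y.
Proof.
move=> mf fC ff.
have mfx n x : measurable_fun setT (f_ n x) by exact: measurable_fun_pair2 x (mf n).
apply: (@bounded_convergence _ _ _ mu _ _ C).
- by move=> n; exact: (@bounded_measurable_fun_Rintegral _ _ _ _ _ mu mu (f_ n) C).
- by move=> n x; apply: Rintegral_bound; [exact: mfx|exact: fC].
- move=> x; apply: (@bounded_convergence _ _ _ mu _ _ C).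
  + by move=> n; exact: mfx.
  + by move=> n y; exact: fC.
  + by move=> y; exact: ff.
Qed.

Lemma cvg_pair_form (mu : probability borelR R) (psi_ : nat -> R -> R)
    (psi : R -> R) (M : R) : 0 <= M ->
  (forall n x y, `|psi_ n x - psi_ n y| <= M * `|x - y|) ->
  (forall x, psi_ n x @[n --> \oo] --> psi x) ->
  pair_form mu (psi_ n) @[n --> \oo] --> pair_form mu psi.
Proof.
move=> M0 psiM psi_cvg; apply: cvgMr.
apply: (@cvg_double_integral _ _ _ M).
- by move=> n; apply: measurable_diff_quot; exact: lipschitz_measurable (psiM n).
- by move=> n x y; exact: diff_quot_bound.
- by move=> x y; apply: cvgMl; apply: cvgB.
Qed.

(** A tent, merely Lipschitz: it multiplies arguments of [pair_form], which are derivatives of test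
    functions. Test functions themselves are cut off by the smoother [bump]. *)
Definition cutoff (n : nat) (x : R) : R := Num.max 0 (1 - `|x| / n.+1%:R).

Lemma cutoff_ge0 n x : 0 <= cutoff n x.
Proof. by rewrite le_max lexx. Qed.

Lemma cutoff_le1 n x : cutoff n x <= 1.
Proof. by rewrite ge_max ler01 gerBl divr_ge0. Qed.

Lemma cutoff_norm n x : `|cutoff n x| <= 1.
Proof. by rewrite ger0_norm ?cutoff_ge0// cutoff_le1. Qed.

Lemma cutoff_out n x : n.+1%:R <= `|x| -> cutoff n x = 0.
Proof.
by move=> h; apply/max_idPl; rewrite subr_le0 ler_pdivlMr ?ltr0n// mul1r.
Qed.

Lemma maxr0_lipschitz (a b : R) : `|Num.max 0 a - Num.max 0 b| <= `|a - b|.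
Proof.
have h1 := ler_norm (a - b); have h2 := ler_norm (b - a); rewrite distrC in h2.
by case: (leP 0 a) => ?; case: (leP 0 b) => ?; rewrite ler_norml; lra.
Qed.

Lemma cutoff_lipschitz n x y : `|cutoff n x - cutoff n y| <= n.+1%:R^-1 * `|x - y|.
Proof.
apply: le_trans (maxr0_lipschitz _ _) _.
have -> : 1 - `|x| / n.+1%:R - (1 - `|y| / n.+1%:R) =
  n.+1%:R^-1 * (`|y| - `|x|) by ring.
by rewrite normrM ger0_norm// ler_wpM2l// distrC ler_dist_dist.
Qed.

Lemma cvg_cutoff x : cutoff n x @[n --> \oo] --> (1 : R).
Proof.
have h : 1 - `|x| / n.+1%:R @[n --> \oo] --> (1 - `|x| * 0 : R).
  apply: cvgB; first exact: cvg_cst.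
  by apply: cvgMr; exact: cvg_harmonic.
rewrite mulr0 subr0 in h.
have : `|cutoff n x - 1| @[n --> \oo] --> (0 : R).
  apply: (@squeeze_cvgr _ _ _ _ (cst 0) (fun n => `|1 - `|x| / n.+1%:R - 1|)).
  - apply: nearW => n; rewrite normr_ge0/=.
    by have := maxr0_lipschitz (1 - `|x| / n.+1%:R) 1; rewrite [Num.max 0 1]max_r.
  - exact: cvg_cst.
  - by rewrite -(normr0 R) -(subrr 1); apply: cvg_norm; apply: cvgB => //; exact: cvg_cst.
by move/norm_cvg0/subr_cvg0.
Qed.

(** Only [x] is confined to [[-A, A]]; [y] ranges over the unit window about [x], as in the
    principal value. *)
Definition locally_lipschitz (v : R -> R) : Prop :=
  forall A : R, exists2 L : R, 0 <= L & forall x y, `|x| <= A ->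
    `|x - y| <= 1 -> `|v x - v y| <= L * `|x - y|.

Variables (mu : probability borelR R) (v : R -> R).
Hypothesis mv : measurable_fun setT v.
Hypothesis muv : has_density mu v.
Hypothesis vlip : locally_lipschitz v.
Local Notation Hn n := (smooth_hilbert (harmonic n) mu).
Local Notation H := (hilbert mu).

Lemma cvg_hilbert x : Hn n x @[n --> \oo] --> H x.
Proof.
have [L L0 vL] := vlip `|x|; apply: (cvg_smooth_hilbert mv muv L0) => y.
exact: vL.
Qed.

Lemma measurable_hilbert : measurable_fun setT H.
Proof.
apply: (@measurable_fun_cvg _ _ _ _ (fun n => Hn n)).
  by move=> n; exact: measurable_smooth_hilbert (harmonic_gt0 n).
by move=> x _; exact: cvg_hilbert.
Qed.

(** Exchange the two variables, use that [q e] is odd, and add the result to the original integral.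
    The singularity is now compensated by [psi x - psi y]. *)
Lemma pair_form_regularized (psi : R -> R) (e C : R) : 0 < e ->
  measurable_fun setT psi -> (forall x, `|psi x| <= C) ->
  2 * \int[mu]_x (psi x * smooth_hilbert e mu x) =
  \int[mu]_x \int[mu]_y ((psi x - psi y) * q e (x - y)).
Proof.
move=> e0 mpsi psiC.
have C0 : 0 <= C by apply: le_trans (psiC 0).
have bq x y : `|q e (x - y)| <= e^-1 by exact: conj_poisson_bound.
have mq2 := measurable_conj_poisson_sub2 e0.
have mp1 : measurable_fun [set: borelR * borelR]
    (fun z => psi z.1 * q e (z.1 - z.2)).
  by apply: measurable_funM => //; exact: measurableT_comp.
have mp2 : measurable_fun [set: borelR * borelR]
    (fun z => psi z.2 * q e (z.1 - z.2)).
  by apply: measurable_funM => //; exact: measurableT_comp.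
have b1 x y : `|psi x * q e (x - y)| <= C * e^-1 by rewrite normrM ler_pM.
have b2 x y : `|psi y * q e (x - y)| <= C * e^-1 by rewrite normrM ler_pM.
have m1x x : measurable_fun setT (fun y : R => psi x * q e (x - y)).
  exact: (measurable_fun_pair2 x mp1).
have m2x x : measurable_fun setT (fun y : R => psi y * q e (x - y)).
  exact: (measurable_fun_pair2 x mp2).
have i1x x : mu.-integrable setT (EFin \o (fun y => psi x * q e (x - y))).
  by apply: (@bounded_integrable _ _ _ mu _ (C * e^-1)); [exact: m1x|exact: b1].
have i2x x : mu.-integrable setT (EFin \o (fun y => psi y * q e (x - y))).
  by apply: (@bounded_integrable _ _ _ mu _ (C * e^-1)); [exact: m2x|exact: b2].
have E1 : \int[mu]_x (psi x * smooth_hilbert e mu x) =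
    \int[mu]_x \int[mu]_y (psi x * q e (x - y)).
  apply: eq_Rintegral => x _; rewrite RintegralZl//.
  exact: conj_poisson_sub_integrable.
have E2 : \int[mu]_x (psi x * smooth_hilbert e mu x) =
    - \int[mu]_x \int[mu]_y (psi y * q e (x - y)).
  rewrite E1 (@bounded_Rintegral_exchange _ _ _ _ _ mu mu
    (fun x y => psi x * q e (x - y)) (C * e^-1))//.
  rewrite -mulN1r -RintegralZl//; last first.
    apply: (@bounded_integrable _ _ _ mu _ (C * e^-1)).
      exact: (@bounded_measurable_fun_Rintegral _ _ _ _ _ mu mu
        (fun x y => psi y * q e (x - y)) (C * e^-1)).
    by move=> x; apply: Rintegral_bound; [exact: m2x|exact: b2].
  apply: eq_Rintegral => x _; rewrite -RintegralZl//.
  apply: eq_Rintegral => y _.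
  by rewrite -(opprB x y) conj_poissonN mulrN mulN1r.
transitivity (\int[mu]_x (\int[mu]_y (psi x * q e (x - y)) -
    \int[mu]_y (psi y * q e (x - y)))).
  rewrite RintegralB//.
  - rewrite -E1; lra.
  - apply: (@bounded_integrable _ _ _ mu _ (C * e^-1)).
      exact: (@bounded_measurable_fun_Rintegral _ _ _ _ _ mu mu
        (fun x y => psi x * q e (x - y)) (C * e^-1)).
    by move=> x; apply: Rintegral_bound; [exact: m1x|exact: b1].
  - apply: (@bounded_integrable _ _ _ mu _ (C * e^-1)).
      exact: (@bounded_measurable_fun_Rintegral _ _ _ _ _ mu mu
        (fun x y => psi y * q e (x - y)) (C * e^-1)).
    by move=> x; apply: Rintegral_bound; [exact: m2x|exact: b2].
apply: eq_Rintegral => x _; rewrite -RintegralB//.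
by apply: eq_Rintegral => y _; rewrite mulrBl.
Qed.

(** Let [e -> 0] in [pair_form_regularized]. On the support of [psi] the regularized transforms are
    bounded by the local Lipschitz constant of the density; on the other side the Lipschitz constant
    of [psi] dominates. *)
Lemma weak_hilbert_compact (psi : R -> R) (A C M : R) : 0 <= M ->
  (forall x y, `|psi x - psi y| <= M * `|x - y|) ->
  (forall x, `|psi x| <= C) -> (forall x, A <= `|x| -> psi x = 0) ->
  \int[mu]_x (psi x * H x) = pair_form mu psi.
Proof.
move=> M0 psiM psiC psi0; have mpsi := lipschitz_measurable psiM.
have [L L0 vL] := vlip A.
have C0 : 0 <= C by apply: le_trans (psiC 0).
have l1 : \int[mu]_x (psi x * Hn n x) @[n --> \oo] --> \int[mu]_x (psi x * H x).
  apply: (@bounded_convergence _ _ _ mu _ _ (C * (2 * L + 1))).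
  - move=> n; apply: measurable_funM => //.
    exact: measurable_smooth_hilbert (harmonic_gt0 n).
  - move=> n x; rewrite normrM; have [xA|xA] := leP A `|x|.
      by rewrite psi0// normr0 mul0r mulr_ge0// addr_ge0// mulr_ge0.
    apply: ler_pM => //.
    apply: (smooth_hilbert_local_bound mv muv (harmonic_gt0 n) L0) => y.
    by apply: vL; exact: ltW.
  - by move=> x; apply: cvgMr; exact: cvg_hilbert.
have l2 : \int[mu]_x (psi x * Hn n x) @[n --> \oo] --> pair_form mu psi.
  have -> : (fun n => \int[mu]_x (psi x * Hn n x)) = (fun n => 2^-1 *
      \int[mu]_x \int[mu]_y ((psi x - psi y) * q (harmonic n) (x - y))).
    apply/funext => n; rewrite -(pair_form_regularized (harmonic_gt0 n) mpsi psiC).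
    by rewrite mulrA mulVf// mul1r.
  apply: cvgMr; apply: (@cvg_double_integral _ _ _ M).
  - move=> n; apply: measurable_funM.
      by apply: measurable_funB; exact: measurableT_comp.
    exact: measurable_conj_poisson_sub2 (harmonic_gt0 n).
  - move=> n x y; apply: (@le_trans _ _ (`|psi x - psi y| * `|x - y|^-1)).
      by rewrite normrM ler_wpM2l//; exact: conj_poisson_le_inv (harmonic_gt0 n).
    by rewrite -normfV -normrM; exact: diff_quot_bound.
  - by move=> x y; apply: cvgMr; apply: cvg_conj_poisson; exact: cvg_harmonic.
exact: cvg_unique l1 l2.
Qed.

(** Compact support is removed by cut-offs. Integrability of [H] dominates the left side; the right
    side only needs a Lipschitz constant uniform in [n]. *)
Lemma weak_hilbert (psi : R -> R) (C M : R) : 0 <= M ->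
  (forall x y, `|psi x - psi y| <= M * `|x - y|) ->
  (forall x, `|psi x| <= C) -> mu.-integrable setT (EFin \o H) ->
  \int[mu]_x (psi x * H x) = pair_form mu psi.
Proof.
move=> M0 psiM psiC iH; have mpsi := lipschitz_measurable psiM.
have C0 : 0 <= C by apply: le_trans (psiC 0).
pose f n x := cutoff n x * psi x.
have mcut n := lipschitz_measurable (@cutoff_lipschitz n).
have mf n : measurable_fun setT (f n) by exact: measurable_funM.
have fpsi x : f n x @[n --> \oo] --> psi x.
  by rewrite -[X in _ --> X]mul1r; apply: cvgMl; exact: cvg_cutoff.
have fle n x : `|f n x| <= `|psi x|.
  by rewrite normrM -[leRHS]mul1r ler_wpM2r// cutoff_norm.
(* The cutoff has slope at most [1 / (n + 1) <= 1], so the product costs [M] plus [C]. *)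
have fM n x y : `|f n x - f n y| <= (M + C) * `|x - y|.
  have -> : f n x - f n y = cutoff n x * (psi x - psi y) +
    (cutoff n x - cutoff n y) * psi y by rewrite /f; ring.
  apply: le_trans (ler_normD _ _) _; rewrite [leRHS]mulrDl; apply: lerD.
    rewrite normrM -[leRHS]mul1r; apply: ler_pM => //; exact: cutoff_norm.
  rewrite normrM mulrC; apply: ler_pM => //.
  apply: le_trans (cutoff_lipschitz _ _ _) _.
  by rewrite -[leRHS]mul1r ler_wpM2r// invf_le1// ler1n.
have l1 : pair_form mu (f n) @[n --> \oo] --> pair_form mu psi.
  by apply: (@cvg_pair_form mu f psi (M + C)) => //; rewrite addr_ge0.
have l2 : \int[mu]_x (f n x * H x) @[n --> \oo] --> \int[mu]_x (psi x * H x).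
  have [|||_ //] := @Rdominated_convergence _ _ _ mu setT
    (fun n x => f n x * H x) (fun x => psi x * H x) (fun x => C * `|H x|)
    measurableT (fun n => measurable_funM (mf n) measurable_hilbert).
  - rewrite /comp; under eq_fun do rewrite EFinM.
    by apply: integrableZl => //; exact: (integrable_norm iH).
  - by move=> n x _; rewrite normrM ler_wpM2r// (le_trans (fle n x)).
  - by move=> x _; apply: cvgMl.
suff e : (fun n => \int[mu]_x (f n x * H x)) = (fun n => pair_form mu (f n)).
  by rewrite e in l2; exact: cvg_unique l2 l1.
apply/funext => n.
apply: (@weak_hilbert_compact _ n.+1%:R C (M + C)) => //.
- by rewrite addr_ge0.
- by move=> x; rewrite (le_trans (fle n x)).
- by move=> x h; rewrite /f cutoff_out// mul0r.
Qed.

End weak_hilbert.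

(** * Convergence of the regularized dissipation *)

Section dissipation.
Context {R : realType}.
Local Notation borelR := (measurableTypeR R).
Local Notation leb := (@lebesgue_measure R).

(** The bound is asked only along a subsequence, which is what the negation of an eventual lower
    bound supplies. *)
Lemma fatou_le d (T : measurableType d) (nu : {measure set T -> \bar R})
    (D : set T) (f_ : nat -> T -> \bar R) (f : T -> \bar R) (B : \bar R) :
  measurable D -> (forall n, measurable_fun D (f_ n)) ->
  (forall n x, D x -> (0 <= f_ n x)%E) ->
  (forall x, D x -> f_ n x @[n --> \oo] --> f x) ->
  (forall N : nat, exists2 n : nat, (N <= n)%N & (\int[nu]_(x in D) f_ n x <= B)%E) ->
  (\int[nu]_(x in D) f x <= B)%E.
Proof.
move=> mD mf f0 ff fB.
have -> : (\int[nu]_(x in D) f x = \int[nu]_(x in D) limn_einf (f_ ^~ x))%E.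
  apply: eq_integral => x /[!inE] Dx.
  by have [-> _] := cvg_limn_einf_sup (ff x Dx).
apply: le_trans (fatou nu mD mf f0) _.
rewrite limn_einf_lim; apply: lime_le; first exact: is_cvg_einfs.
apply: nearW => N; have [n Nn nB] := fB N.
apply: le_trans nB; apply: ereal_inf_lbound; exists n => //.
Qed.

Variables (mu : probability borelR R) (v : R -> R).
Hypothesis mv : measurable_fun setT v.
Hypothesis muv : has_density mu v.
Hypothesis vlip : locally_lipschitz v.
Local Notation Hn n := (smooth_hilbert (harmonic n) mu).
Local Notation H := (hilbert mu).
Local Notation D n := (pair_form mu (Hn n)).
Local Notation X := (\int[mu]_x (H x ^+ 2)%:E)%E.

Let mH : measurable_fun setT H.
Proof. exact: measurable_hilbert mv muv vlip. Qed.

Let mHn n : measurable_fun setT (Hn n).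
Proof. exact: measurable_smooth_hilbert (harmonic_gt0 n). Qed.

Let Hn_sqr_integrable n : mu.-integrable setT (EFin \o (fun x => Hn n x ^+ 2)).
Proof.
apply: (@bounded_integrable _ _ _ mu _ ((harmonic n)^-1 ^+ 2)).
  by apply: measurable_funX; exact: mHn.
move=> x; rewrite normrX lerXn2r ?nnegrE ?invr_ge0//.
exact: (smooth_hilbert_bound mu (harmonic_gt0 n)).
Qed.

Let D_ge n : \int[mu]_x Hn n x ^+ 2 <= 2 * D n.
Proof. exact: pair_form_smooth_hilbert_ge (harmonic_gt0 n). Qed.

Lemma pair_form_smooth_hilbert_ge0 n : 0 <= D n.
Proof.
rewrite -(pmulr_rge0 _ (ltr0Sn R 1)); apply: le_trans (D_ge n).
by apply: Rintegral_ge0 => x _; exact: sqr_ge0.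
Qed.

Section finite_fisher.
Hypothesis Xfin : (X < +oo)%E.

Let H2i : mu.-integrable setT (EFin \o (fun x => H x ^+ 2)).
Proof.
apply/integrableP; split; first by apply/measurable_EFinP; (apply: measurable_funX; (exact: mHn || exact: mH || exact: (mf n))).
under eq_integral do rewrite /= ger0_norm ?sqr_ge0//.
exact: Xfin.
Qed.

Let Hi : mu.-integrable setT (EFin \o H).
Proof.
apply: (@dominated_integrable _ _ _ mu setT _ (fun x => H x ^+ 2 + 1)) => //.
  by apply: integrable_EFinD => //; exact: finite_measure_integrable_cst.
move=> x _; rewrite -(real_normK (num_real (H x))).
by have := normr_ge0 (H x); nra.
Qed.

Let DE n : D n = \int[mu]_x (Hn n x * H x).
Proof.
apply/esym; apply: (@weak_hilbert _ mu v mv muv vlip _ (harmonic n)^-1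
  (harmonic n ^- 2)) => //.
- by rewrite invr_ge0 sqr_ge0.
- exact: (smooth_hilbert_lipschitz mu (harmonic_gt0 n)).
- exact: (smooth_hilbert_bound mu (harmonic_gt0 n)).
Qed.

Let HHni n : mu.-integrable setT (EFin \o (fun x => Hn n x * H x)).
Proof.
have mHnn := mHn n; have iHn := Hn_sqr_integrable n.
apply: (@dominated_integrable _ _ _ mu setT _ (fun x => Hn n x ^+ 2 + H x ^+ 2)) => //.
- exact: measurable_funM.
- exact: integrable_EFinD.
move=> x _; rewrite normrM.
rewrite -(real_normK (num_real (H x))) -(real_normK (num_real (Hn n x))).
by have := normr_ge0 (H x); have := normr_ge0 (Hn n x); nra.
Qed.

Let Y := \int[mu]_x H x ^+ 2.

Lemma pair_form_smooth_hilbert_le n : D n <= 2 * Y.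
Proof.
have mHnn := mHn n; have iHn := Hn_sqr_integrable n; have HHnin := HHni n.
(* Young's inequality, weighted by [4^-1] so that [D_ge] turns the first term into at most half of
   [D n], which is then absorbed. *)
have h : D n <= 4^-1 * \int[mu]_x Hn n x ^+ 2 + Y.
  rewrite DE /Y -RintegralZl// -RintegralD//; last first.
    exact: integrable_EFinZl.
  apply: le_Rintegral => //.
    by apply: integrable_EFinD => //; exact: integrable_EFinZl.
  by move=> x _; have := sqr_ge0 (2^-1 * Hn n x - H x); lra.
by have := D_ge n; lra.
Qed.

(* [H_n] is bounded in [L^2(mu)] and converges pointwise to [H], hence
   converges weakly: where [|H_n - H| <= K |H|] the product [(H_n - H) H] is
   dominated by [K H^2], and elsewhere it is at most [(H_n - H)^2 / K]. *)
Lemma cvg_pair_form_smooth_hilbert : D n @[n --> \oo] --> Y.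
Proof.
pose f n x := Hn n x - H x.
have mf n : measurable_fun setT (f n) by exact: measurable_funB.
have fi n : mu.-integrable setT (EFin \o (fun x => f n x ^+ 2)).
  have mHnn := mHn n; have iHn := Hn_sqr_integrable n.
  apply: (@dominated_integrable _ _ _ mu setT _
    (fun x => 2 * (Hn n x ^+ 2 + H x ^+ 2))) => //.
  - (apply: measurable_funX; (exact: mHn || exact: mH || exact: (mf n))).
  - by apply: integrable_EFinZl => //; exact: integrable_EFinD.
  - move=> x _; rewrite ger0_norm ?sqr_ge0// /f.
    by have := sqr_ge0 (Hn n x + H x); lra.
have Y0 : 0 <= Y by apply: Rintegral_ge0 => x _; exact: sqr_ge0.
(* From [D_ge] and the previous lemma [\int H_n^2 <= 2 * D n <= 4 * Y], and
   [2 * (4 * Y + Y) = 10 * Y]. *)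
have f2 n : \int[mu]_x f n x ^+ 2 <= 10 * Y.
  have mHnn := mHn n; have iHn := Hn_sqr_integrable n; have fin := fi n.
  apply: (@le_trans _ _ (\int[mu]_x (2 * (Hn n x ^+ 2 + H x ^+ 2)))).
    apply: le_Rintegral => //.
      by apply: integrable_EFinZl => //; exact: integrable_EFinD.
    by move=> x _; rewrite /f; have := sqr_ge0 (Hn n x + H x); lra.
  rewrite RintegralZl//; last first.
    exact: integrable_EFinD.
  rewrite RintegralD// -/Y.
  by have := D_ge n; have := pair_form_smooth_hilbert_le n; lra.
have fHi n : mu.-integrable setT (EFin \o (fun x => f n x * H x)).
  have HHnin := HHni n.
  rewrite (_ : (fun x => f n x * H x) = (fun x => Hn n x * H x - H x ^+ 2)).
    exact: integrable_EFinB.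
  by apply/funext => x /=; rewrite /f mulrBl expr2.
have e n : D n - Y = \int[mu]_x (f n x * H x).
  have HHnin := HHni n.
  rewrite DE /Y -RintegralB//.
  by apply: eq_Rintegral => x _; rewrite /f mulrBl expr2.
apply/cvgrPdist_le => eps eps0.
(* Chosen so that [10 * Y / K <= eps / 2]; the [+ 1] keeps [K] positive when [Y = 0]. *)
pose K := 20 * (Y + 1) / eps.
have K0 : 0 < K by rewrite divr_gt0// mulr_gt0// ltr_pwDr.
pose g n x := Num.min (`|f n x * H x|) (K * H x ^+ 2).
have g0 n x : 0 <= g n x.
  by rewrite le_min normr_ge0 mulr_ge0 ?sqr_ge0// ltW.
have mg n : measurable_fun setT (g n).
  have mfn := mf n.
  apply: measurable_minr.
    by apply: measurableT_comp => //; exact: measurable_funM.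
  by apply: measurable_funM => //; (apply: measurable_funX; (exact: mHn || exact: mH || exact: (mf n))).
have iKH : mu.-integrable setT (EFin \o (fun x => K * H x ^+ 2)).
  exact: integrable_EFinZl.
have gK n x : `|g n x| <= K * H x ^+ 2 by rewrite ger0_norm// ge_min lexx orbT.
have gi n : mu.-integrable setT (EFin \o g n).
  have mgn := mg n.
  by apply: (@dominated_integrable _ _ _ mu setT _ (fun x => K * H x ^+ 2)).
have [|||_ gcvg] := @Rdominated_convergence _ _ _ mu setT g (cst 0)
    (fun x => K * H x ^+ 2) measurableT mg.
- exact: iKH.
- by move=> n x _; exact: gK.
- move=> x _; apply: (@squeeze_cvgr _ _ _ _ (cst 0) (fun n => `|f n x * H x|)).
  + by apply: nearW => n; rewrite g0 ge_min lexx.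
  + exact: cvg_cst.
  + rewrite -(normr0 R) -(mul0r (H x)) -(subrr (H x)).
    apply: cvg_norm; apply: cvgMl; apply: cvgB; last exact: cvg_cst.
    exact: (cvg_hilbert mv muv vlip).
rewrite Rintegral_cst// mul0r in gcvg.
have fg n x : `|f n x * H x| <= g n x + K^-1 * f n x ^+ 2.
  rewrite /g; case: (leP `|f n x * H x| (K * H x ^+ 2)) => h.
    by rewrite lerDl mulr_ge0 ?sqr_ge0// invr_ge0 ltW.
  apply: (@le_trans _ _ (K^-1 * f n x ^+ 2)); last first.
    by rewrite lerDr mulr_ge0 ?sqr_ge0// ltW.
  rewrite [leRHS]mulrC ler_pdivlMr//; move: h; rewrite normrM.
  rewrite -(real_normK (num_real (f n x))) -(real_normK (num_real (H x))).
  have := normr_ge0 (f n x); have := normr_ge0 (H x).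
  move: `|f n x| `|H x| => a b b0 a0 h.
  have b1 : 0 < b.
    by rewrite lt_neqAle b0 andbT; apply: contraTneq h => <-; rewrite expr0n !mulr0 ltxx.
  have : K * b < a by rewrite -(ltr_pM2r b1) -mulrA -expr2.
  by move=> Kb; rewrite expr2 -mulrA ler_wpM2l// mulrC ltW.
move/cvgrPdist_le : gcvg => /(_ _ (divr_gt0 eps0 (ltr0Sn R 1))).
apply: filterS => n.
rewrite sub0r normrN ger0_norm; last by apply: Rintegral_ge0.
move=> hn; rewrite distrC e.
have fin := fi n; have gin := gi n; have fHin := fHi n.
apply: le_trans (le_normr_Rintegral measurableT (fHi n)) _.
apply: (@le_trans _ _ (\int[mu]_x (g n x + K^-1 * f n x ^+ 2))).
  apply: le_Rintegral => //; first exact: integrable_norm.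
  by apply: integrable_EFinD => //; exact: integrable_EFinZl.
rewrite RintegralD//; last first.
  exact: integrable_EFinZl.
rewrite RintegralZl//.
have : K^-1 * \int[mu]_x f n x ^+ 2 <= eps / 2; last by move: hn; lra.
apply: (@le_trans _ _ (K^-1 * (10 * Y))).
  by rewrite ler_wpM2l// invr_ge0 ltW.
rewrite /K invf_div -mulrA ler_pM2l// mulrC ler_pdivrMr ?mulr_gt0 ?ltr_pwDr//.
lra.
Qed.

End finite_fisher.

Lemma cvg_dissipation : (D n)%:E @[n --> \oo] --> X.
Proof.
have [Xfin|] := ltP X +oo%E.
  have -> : X = (\int[mu]_x H x ^+ 2)%:E.
    by rewrite fineK// ge0_fin_numE// integral_ge0// => x _; rewrite lee_fin sqr_ge0.
  by apply: cvg_EFin; [exact: nearW|exact: cvg_pair_form_smooth_hilbert].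
rewrite leye_eq => /eqP XE; rewrite XE; apply/cvgeyPger => A _.
(* Otherwise [D n < A] for infinitely many [n], hence [\int H_n^2 <= 2 * A] for these, and Fatou
   would make the limit finite. *)
apply: contrapT => /= nA.
suff : (X <= (2 * A)%:E)%E by rewrite XE leye_eq.
apply: (@fatou_le _ _ mu setT (fun n x => (Hn n x ^+ 2)%:E)) => //.
- by move=> n; apply/measurable_EFinP; (apply: measurable_funX; (exact: mHn || exact: mH || exact: (mf n))).
- by move=> n x _; rewrite lee_fin sqr_ge0.
- move=> x _; apply: cvg_EFin; first exact: nearW.
  have h := @cvg_hilbert _ _ _ mv muv vlip x.
  by rewrite expr2; under eq_fun do rewrite expr2; exact: cvgM.
- move=> N; apply: contrapT => nN; apply: nA; exists N => // n /= Nn.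
  rewrite lee_fin leNgt; apply/negP => DA; apply: nN; exists n => //.
  rewrite -[leLHS]fineK; last exact: integrable_fin_num (Hn_sqr_integrable n).
  rewrite lee_fin; apply: (le_trans (D_ge n)).
  by rewrite ler_pM2l// ltW.
Qed.

Lemma dissipation_dominated n : ((D n)%:E <= 2%:E * X)%E.
Proof.
have [Xfin|] := ltP X +oo%E; last first.
  by rewrite leye_eq => /eqP ->; rewrite gt0_muley ?leey// lte_fin.
have -> : X = (\int[mu]_x H x ^+ 2)%:E.
  by rewrite fineK// ge0_fin_numE// integral_ge0// => x _; rewrite lee_fin sqr_ge0.
by rewrite lee_fin; exact: pair_form_smooth_hilbert_le.
Qed.

End dissipation.

(** * Calculus on the line *)

Section calculus.
Context {R : realType}.
Local Notation leb := (@lebesgue_measure R).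

Lemma is_derive_le (f : R -> R) (x d : R) :
  (forall eps, 0 < eps -> \forall z \near x,
    `|f z - f x - d * (z - x)| <= eps * `|z - x|) ->
  is_derive x 1 f d.
Proof.
move=> fd; apply/is_derive1_caratheodory.
exists (fun z => if z == x then d else (f z - f x) / (z - x)); split.
- move=> z; case: eqVneq => [->|zx]; first by rewrite !subrr mulr0.
  by rewrite mulfVK// subr_eq0.
- rewrite /prop_for /continuous_at eqxx; apply/cvgrPdist_le => eps eps0.
  apply: filterS (fd _ eps0) => z; case: eqVneq => [->|zx] /=.
    by move=> _; rewrite subrr normr0 ltW.
  have zx0 : 0 < `|z - x| by rewrite normr_gt0 subr_eq0.
  by move=> h; rewrite -(ler_pM2r zx0) -normrM mulrBl mulfVK ?subr_eq0// [leLHS]distrC.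
- by rewrite eqxx.
Qed.

(** A quadratic remainder can be integrated against a probability measure, so this criterion
    replaces differentiation under the integral sign for potentials. *)
Lemma is_derive_quadratic (f : R -> R) (x d K : R) :
  (forall z, `|f z - f x - d * (z - x)| <= K * (z - x) ^+ 2) ->
  is_derive x 1 f d.
Proof.
move=> fK; apply: is_derive_le => eps eps0.
have K0 : 0 < `|K| + 1 by rewrite ltr_pwDr.
near=> z; apply: le_trans (fK z) _.
rewrite -(real_normK (num_real (z - x))) expr2 mulrA ler_wpM2r//.
apply: (@le_trans _ _ ((`|K| + 1) * `|z - x|)).
  by rewrite ler_wpM2r// (le_trans (ler_norm K))// lerDl.
rewrite mulrC -ler_pdivlMr// distrC; near: z.
have := @cvg_id _ (nbhs x); move/cvgrPdist_le; apply.
by rewrite divr_gt0.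
Unshelve. all: by end_near. Qed.

Lemma is_derive_continuous (f : R -> R) (x d : R) :
  is_derive x 1 f d -> {for x, continuous f}.
Proof. by move=> fd; apply/differentiable_continuous/derivable1_diffP; exact: ex_derive. Qed.

Lemma is_derive_lipschitz (f df : R -> R) (C : R) :
  (forall x : R, is_derive x 1 f (df x)) -> (forall x, `|df x| <= C) ->
  forall x y, `|f x - f y| <= C * `|x - y|.
Proof.
move=> fd dfC.
have wlogt x y : x < y -> `|f x - f y| <= C * `|x - y|.
  move=> xy; have [|c _ e] := @MVT R f df x y xy (fun z _ => fd z).
    by apply: continuous_subspaceT => z; exact: is_derive_continuous (fd z).
  by rewrite distrC e normrM [X in _ <= C * X]distrC ler_wpM2r.
move=> x y; case: (ltgtP x y) => [| |->]; first exact: wlogt.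
  by move=> yx; rewrite distrC [X in C * X]distrC; exact: wlogt.
by rewrite !subrr normr0 mulr0.
Qed.

(** At time [0] the flow has no derivative, only right continuity. The uniform bound [C] makes the
    integral of [W] over [[0, s]] of order [s], so the identity on positive times extends to
    [s = 0]. *)
Lemma ftc_right0 (g W : R -> R) (C : R) :
  (forall r, 0 < r -> {for r, continuous W}) ->
  (forall r, 0 <= r -> `|W r| <= C) ->
  (forall r : R, 0 < r -> is_derive r 1 g (W r)) ->
  g x @[x --> 0^'+] --> g 0 ->
  forall s t, 0 <= s -> s <= t ->
  leb.-integrable `[s, t] (EFin \o W) /\
  g t - g s = \int[leb]_(r in `[s, t]) W r.
Proof.
move=> cW WC gW g0.
have C0 : 0 <= C by apply: le_trans (WC 0 (lexx 0)).
have mW : measurable_fun (`[(0:R), +oo[%classic : set R) W.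
  apply/measurable_fun_itv_obnd_cbndP; apply: open_continuous_measurable_fun.
    exact: interval_open.
  by move=> r; rewrite inE/= in_itv/= andbT; exact: cW.
have iW s t : 0 <= s -> leb.-integrable `[s, t] (EFin \o W).
  move=> s0; apply: measurable_bounded_integrable => //.
  - by rewrite [X in (X < _)%E]lebesgue_measure_itv/=; case: ifP => _; rewrite -?EFinB ltry.
  - apply: measurable_funS mW => // r /=.
    by rewrite !in_itv/= andbT => /andP[sr _]; exact: le_trans sr.
  - exists C; split; first exact: num_real.
    move=> M CM r /=; rewrite in_itv/= => /andP[sr _].
    by apply: le_trans (ltW CM); apply: WC; exact: le_trans sr.
have pos s t : 0 < s -> s < t -> g t - g s = \int[leb]_(r in `[s, t]) W r.
  move=> s0 st; rewrite /Rintegral (@continuous_FTC2 _ W g)//.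
  - apply: continuous_in_subspaceT => r; rewrite inE/= in_itv/= => /andP[sr _].
    by apply: cW; exact: lt_le_trans sr.
  - split.
    + move=> r; rewrite in_itv/= => /andP[sr _].
      by apply: ex_derive; apply: gW; exact: lt_trans sr.
    + exact/cvg_at_right_filter/(is_derive_continuous (gW s s0)).
    + exact/cvg_at_left_filter/(is_derive_continuous (gW t (lt_trans s0 st))).
  - move=> r; rewrite in_itv/= => /andP[sr _]; rewrite derive1E.
    by have [_ ->] := gW r (lt_trans s0 sr).
move=> s t s0 st; split; first exact: iW.
move: st; rewrite le_eqVlt => /predU1P[<-|st].
  by rewrite subrr set_itv1 Rintegral_set1.
move: s0; rewrite le_eqVlt => /predU1P[s0|s0]; last exact: pos.
subst s.
pose J s := \int[leb]_(r in `[0, s]) W r.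
have JC s : 0 <= s -> `|J s| <= C * s.
  move=> s0; apply: le_trans (le_normr_Rintegral _ (iW 0 s (lexx 0))) _ => //.
  apply: (@le_trans _ _ (\int[leb]_(r in `[0, s]) C)).
    apply: le_Rintegral => //.
    - exact: integrable_norm (iW 0 s (lexx 0)).
    - apply: measurable_bounded_integrable => //; last exact: bounded_cst.
      by rewrite [X in (X < _)%E]lebesgue_measure_itv/=; case: ifP => _; rewrite -?EFinB ltry.
    - by move=> r /=; rewrite in_itv/= => /andP[r0 _]; exact: WC.
  rewrite Rintegral_cst// [X in fine X]lebesgue_measure_itv/= lte_fin.
  by move: s0; rewrite le_eqVlt => /predU1P[<-|->]; rewrite ?ltxx//= subr0.
(* This quantity does not depend on small [s > 0]; its limit at [0] is computed in two ways
   below. *)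
have E : \forall s \near 0^'+, g t - g s + J s = J t.
  near=> s; have s0 : 0 < s by [].
  have st' : s < t by near: s; exact: nbhs_right_lt.
  rewrite (pos s t s0 st') /J -Rintegral_itv_obnd_cbnd; last first.
    apply: integrableS (iW s t (ltW s0)) => //.
    exact: subset_itv_oc_cc.
  rewrite -(@Rintegral_itvB _ W (BLeft 0) (BRight t) s) ?subrK//.
  - exact: iW.
  - by rewrite bnd_simp ltW.
  - by rewrite bnd_simp ltW.
have l1 : g t - g s + J s @[s --> 0^'+] --> g t - g 0 + 0.
  apply: cvgD; first by apply: cvgB => //; exact: cvg_cst.
  apply: norm_cvg0.
  apply: (@squeeze_cvgr _ _ _ _ (cst 0) (fun s => C * s)).
  - near=> s; rewrite normr_ge0/=; apply: JC.
    by apply: ltW.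
  - exact: cvg_cst.
  - rewrite -[X in _ --> X](mulr0 C); apply: cvgMr.
    exact/cvg_at_right_filter/cvg_id.
have l2 : g t - g s + J s @[s --> 0^'+] --> J t.
  apply: cvg_near_cst; exact: E.
by rewrite -[LHS]addr0; exact: (cvg_unique _ l1 l2).
Unshelve. all: by end_near. Qed.

End calculus.

(** * Dependence of the pair form on the measure and on the test function *)

Section pair_form_theory.
Context {R : realType}.
Local Notation borelR := (measurableTypeR R).
Local Notation leb := (@lebesgue_measure R).

Lemma locally_lipschitz_continuous (v : R -> R) :
  locally_lipschitz v -> continuous v.
Proof.
move=> vl x; have [L L0 vL] := vl `|x|.
apply/cvgrPdist_le => e e0.
have L1 : 0 < L + 1 by rewrite ltr_pwDr.
have d0 : 0 < Num.min 1 (e / (L + 1)) by rewrite lt_min ltr01 divr_gt0.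
have := @cvg_id _ (nbhs x); move/cvgrPdist_le => /(_ _ d0); apply: filterS => y.
rewrite le_min => /andP[xy1 xye].
apply: le_trans (vL x y (lexx _) xy1) _.
apply: (@le_trans _ _ ((L + 1) * `|x - y|)); first by rewrite ler_wpM2r// lerDl.
by rewrite mulrC -ler_pdivlMr.
Qed.

Lemma locally_lipschitz_measurable (v : R -> R) :
  locally_lipschitz v -> measurable_fun setT v.
Proof.
by move=> vl; apply: continuous_measurable_fun; exact: locally_lipschitz_continuous.
Qed.

Section bounds.
Variables (psi : R -> R) (M : R).
Hypothesis M0 : 0 <= M.
Hypothesis psiM : forall x y, `|psi x - psi y| <= M * `|x - y|.

Let mdq : measurable_fun [set: borelR * borelR] (fun z => diff_quot psi z.1 z.2).
Proof. by apply: measurable_diff_quot; exact: lipschitz_measurable psiM. Qed.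

Let dqM x y : `|diff_quot psi x y| <= M.
Proof. exact: diff_quot_bound. Qed.

Let mdqx x : measurable_fun setT (diff_quot psi x).
Proof. exact: (measurable_fun_pair2 x mdq). Qed.

Let mIdq (mu : probability borelR R) :
  measurable_fun setT (fun x => \int[mu]_y diff_quot psi x y).
Proof. exact: (@bounded_measurable_fun_Rintegral _ _ _ _ _ mu mu _ M). Qed.

Let Idq (mu : probability borelR R) x : `|\int[mu]_y diff_quot psi x y| <= M.
Proof. by apply: Rintegral_bound; [exact: mdqx|exact: dqM]. Qed.

Lemma pair_form_bound (mu : probability borelR R) : `|pair_form mu psi| <= M.
Proof.
rewrite normrM (ger0_norm (_ : 0 <= 2^-1))//.
have := @Rintegral_bound _ _ _ mu _ M (mIdq mu) (Idq mu).
by have := normr_ge0 (\int[mu]_x \int[mu]_y diff_quot psi x y); lra.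
Qed.

(** The two copies of the measure are replaced one at a time; the two errors [M * T] are compensated
    by the factor [2^-1] of [pair_form]. *)
Lemma pair_form_density_sub (mu nu : probability borelR R) (v w : R -> R) :
  measurable_fun setT v -> has_density mu v ->
  measurable_fun setT w -> has_density nu w ->
  `|pair_form mu psi - pair_form nu psi| <= M * \int[leb]_x `|v x - w x|.
Proof.
move=> mv muv mw nuw; rewrite /pair_form -mulrBr normrM.
rewrite (ger0_norm (_ : 0 <= 2^-1))// mulrC ler_pdivrMr//.
set T := \int[leb]_x _.
have h1 := Rintegral_density_sub mv muv mw nuw (mIdq mu) (Idq mu).
have inu (P : probability borelR R) :
    nu.-integrable setT (EFin \o (fun x => \int[P]_y diff_quot psi x y)).
  by apply: (@bounded_integrable _ _ _ nu _ M); [exact: mIdq|exact: Idq].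
have h2 : `|\int[nu]_x \int[mu]_y diff_quot psi x y -
    \int[nu]_x \int[nu]_y diff_quot psi x y| <= M * T.
  rewrite -RintegralB//; try exact: inu.
  apply: Rintegral_bound; first by apply: measurable_funB; exact: mIdq.
  by move=> x; exact: Rintegral_density_sub mv muv mw nuw (mdqx x) (dqM x).
rewrite (_ : _ - _ = (\int[mu]_x \int[mu]_y diff_quot psi x y -
   \int[nu]_x \int[mu]_y diff_quot psi x y) +
  (\int[nu]_x \int[mu]_y diff_quot psi x y -
    \int[nu]_x \int[nu]_y diff_quot psi x y)); last by rewrite addrA subrK.
apply: le_trans (ler_normD _ _) _.
by rewrite mulrDr mulr1 lerD.
Qed.

End bounds.

Lemma pair_formB (mu : probability borelR R) (psi1 psi2 : R -> R) (M1 M2 : R) :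
  0 <= M1 -> (forall x y, `|psi1 x - psi1 y| <= M1 * `|x - y|) ->
  0 <= M2 -> (forall x y, `|psi2 x - psi2 y| <= M2 * `|x - y|) ->
  pair_form mu psi1 - pair_form mu psi2 = pair_form mu (fun x => psi1 x - psi2 x).
Proof.
move=> M10 h1 M20 h2; rewrite /pair_form -mulrBr; congr (_ * _).
have i1 (psi : R -> R) (M : R) : 0 <= M ->
    (forall x y, `|psi x - psi y| <= M * `|x - y|) -> forall x,
    mu.-integrable setT (EFin \o diff_quot psi x).
  move=> M0 h x; apply: (@bounded_integrable _ _ _ mu _ M).
    have mpsi := measurable_diff_quot (lipschitz_measurable h).
    exact: (measurable_fun_pair2 x mpsi).
  by move=> y; exact: diff_quot_bound.
have i2 (psi : R -> R) (M : R) : 0 <= M ->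
    (forall x y, `|psi x - psi y| <= M * `|x - y|) ->
    mu.-integrable setT (EFin \o (fun x => \int[mu]_y diff_quot psi x y)).
  move=> M0 h; have mpsi := measurable_diff_quot (lipschitz_measurable h).
  apply: (@bounded_integrable _ _ _ mu _ M).
    apply: (@bounded_measurable_fun_Rintegral _ _ _ _ _ mu mu _ M) => //.
    by move=> x y; exact: diff_quot_bound.
  move=> x; apply: Rintegral_bound; first exact: (measurable_fun_pair2 x mpsi).
  by move=> y; exact: diff_quot_bound.
rewrite -(RintegralB _ (i2 _ _ M10 h1) (i2 _ _ M20 h2))//.
apply: eq_Rintegral => x _.
rewrite -(RintegralB _ (i1 _ _ M10 h1 x) (i1 _ _ M20 h2 x))//.
by apply: eq_Rintegral => y _; rewrite /diff_quot; ring.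
Qed.

End pair_form_theory.

(** * Weak form of the equation *)

Section flow.
Context {R : realType}.
Local Notation borelR := (measurableTypeR R).
Local Notation leb := (@lebesgue_measure R).
Variables (m : R -> probability borelR R) (u ut : R -> R -> R).
Hypothesis mu_density : forall t : R, 0 < t -> has_density (m t) (u t).
Hypothesis u_lip : forall t : R, 0 < t -> locally_lipschitz (u t).
Hypothesis u_derive : forall t x : R, 0 < t -> is_derive t 1 (u ^~ x) (ut t x).
Hypothesis ut_continuous : forall p : R^o * R^o, 0 < p.1 ->
  {for p, continuous (fun z : R^o * R^o => ut z.1 z.2 : R^o)}.
Hypothesis flux_derive : forall t x : R, 0 < t ->
  is_derive x 1 (fun y => u t y * hilbert (m t) y) (- ut t x).

Lemma measurable_flow t : 0 < t -> measurable_fun setT (u t).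
Proof. by move=> t0; exact: locally_lipschitz_measurable (u_lip t0). Qed.

(** Differentiability in time gives pointwise convergence of the densities, and Scheffe's lemma does
    the rest, without uniform decay in [x]. *)
Lemma cvg_total_variation t : 0 < t ->
  \int[leb]_x `|u s x - u t x| @[s --> t] --> 0.
Proof.
(* A sequence tending to [t] may start with nonpositive times, where there is no density; truncation
   at [t / 2] changes nothing near [t]. *)
move=> t0; pose s_ (s : R) := Num.max s (t / 2).
have t20 : 0 < t / 2 by rewrite divr_gt0.
have s0 s : 0 < s_ s by rewrite lt_max t20 orbT.
have : \int[leb]_x `|u (s_ s) x - u t x| @[s --> t] --> 0.
  apply/(@cvg_nbhsP R R^o) => tn tnt.
  apply: (@scheffe _ (fun n => m (s_ (tn n))) (m t)).
  - by move=> n; exact: measurable_flow.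
  - exact: measurable_flow.
  - by move=> n; exact: mu_density.
  - exact: mu_density.
  - move=> x.
    have st : s_ (tn n) @[n --> \oo] --> t.
      apply/cvgrPdist_le => e e0.
      move/cvgrPdist_le : tnt => /(_ _ e0); apply: filterS => n.
      rewrite /s_ !ler_norml; case: (leP (tn n) (t / 2)) => h /andP[h1 h2]; lra.
    exact: (continuous_cvg _ (is_derive_continuous (u_derive x t0)) st).
apply: cvg_trans; apply: near_eq_cvg; near=> s.
rewrite /s_ max_l//; apply: ltW; near: s; apply: lt_nbhsr.
by rewrite gtr_pMr// invf_lt1// ltr1n.
Unshelve. all: by end_near. Qed.

Lemma continuous_total_variation (f : R -> R) (t C : R) : 0 < t ->
  (forall s, 0 < s -> `|f s - f t| <= C * \int[leb]_x `|u s x - u t x|) ->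
  {for t, continuous f}.
Proof.
move=> t0 fC; apply/cvgrPdist_le => e e0.
have C1 : 0 < `|C| + 1 by rewrite ltr_pwDr.
have ed0 : 0 < e / (`|C| + 1) by rewrite divr_gt0.
have := cvg_total_variation t0; move/cvgrPdist_le => /(_ _ ed0) tv.
near=> s; have s0 : 0 < s by near: s; exact: lt_nbhsr.
rewrite distrC; apply: (le_trans (fC s s0)).
have : `|0 - \int[leb]_x `|u s x - u t x| | <= e / (`|C| + 1) by near: s.
have T0 : 0 <= \int[leb]_x `|u s x - u t x| by apply: Rintegral_ge0.
rewrite sub0r normrN ger0_norm// ler_pdivlMr// => h.
apply: le_trans h; rewrite mulrC ler_wpM2l// (le_trans (ler_norm C))//.
by rewrite lerDl.
Unshelve. all: by end_near. Qed.

Lemma ut_rectangle_bound a b A : 0 < a -> exists M : R, forall t x,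
  a <= t <= b -> - A <= x <= A -> `|ut t x| <= M.
Proof.
move=> a0; pose K : set (R^o * R^o) := `[a, b] `*` `[- A, A].
have cK : compact K by apply: compact_setX; exact: segment_compact.
have cut : {within K, continuous (fun z : R^o * R^o => ut z.1 z.2 : R^o)}.
  apply: continuous_in_subspaceT => p; rewrite inE => -[/= + _].
  by rewrite in_itv/= => /andP[ap _]; apply: ut_continuous; exact: lt_le_trans ap.
have [M [_ Mb]] := compact_bounded (continuous_compact cut cK).
exists (`|M| + 1) => t x abt Ax; apply: (Mb (`|M| + 1)).
  by rewrite ltr_pwDr// ler_norm.
by exists (t, x) => //; split; rewrite /= in_itv.
Qed.

Section compact_test.
Variables (phi dphi : R -> R) (A C M : R).
Hypothesis A0 : 0 < A.
Hypothesis M0 : 0 <= M.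
Hypothesis phi_derive : forall x : R, is_derive x 1 phi (dphi x).
Hypothesis dphiM : forall x y, `|dphi x - dphi y| <= M * `|x - y|.
Hypothesis dphiC : forall x, `|dphi x| <= C.
Hypothesis phi_out : forall x, A <= `|x| -> phi x = 0.
Hypothesis dphi_out : forall x, A <= `|x| -> dphi x = 0.

Let B : set borelR := `[- A, A].

Let out x : x \notin B -> A <= `|x|.
Proof.
apply: contraNle; rewrite ltr_norml => /andP[h1 h2].
by rewrite inE /B /= in_itv/= !ltW.
Qed.

Let RintegralB_out (f g : R -> R) : (forall x, A <= `|x| -> f x = 0) ->
  \int[leb]_(x in B) (f x * g x) = \int[leb]_x (f x * g x).
Proof.
move=> f0; rewrite Rintegral_mkcond; apply: eq_Rintegral => x _.
by rewrite patchE; case: ifPn => // /out/f0 ->; rewrite mul0r.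
Qed.

Let cphi : continuous phi.
Proof. by move=> x; exact: is_derive_continuous (phi_derive x). Qed.

Let mphi : measurable_fun setT phi.
Proof. exact: continuous_measurable_fun. Qed.

Let mdphi : measurable_fun setT dphi.
Proof. exact: lipschitz_measurable dphiM. Qed.

(** Differentiate under the integral, insert the equation, integrate by parts in [x], and symmetrize
    the flux term by [weak_hilbert_compact]. *)
Lemma weak_derive (t : R) : 0 < t ->
  is_derive t 1 (fun s => \int[m s]_x phi x) (pair_form (m t) dphi).
Proof.
move=> t0.
have mH s : 0 < s -> measurable_fun setT (hilbert (m s)).
  by move=> s0; exact: measurable_hilbert (measurable_flow s0) (mu_density s0) (u_lip s0).
(* Restricting to the compact [B] makes integrability and domination matters of continuity. *)
pose G s := \int[leb]_(x in B) (phi x * u s x).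
have gG s : 0 < s -> \int[m s]_x phi x = G s.
  move=> s0; rewrite (Rintegral_density (measurable_flow s0) (mu_density s0) mphi).
  by rewrite /G RintegralB_out.
apply: (@near_eq_is_derive _ _ _ G).
  by near=> s; rewrite gG//; near: s; exact: lt_nbhsr.
(* A time window that stays away from [0], where [ut] is not controlled. *)
have Nuab : `]t / 2, 2 * t[%classic t by rewrite /= in_itv/=; lra.
have pos s : `]t / 2, 2 * t[%classic s -> 0 < s.
  by rewrite /= in_itv/= => /andP[h _]; lra.
have intf s : `]t / 2, 2 * t[%classic s ->
    leb.-integrable B (EFin \o (fun x => phi x * u s x)).
  move=> /pos s0; apply: continuous_compact_integrable; first exact: segment_compact.
  apply: continuous_subspaceT => x; apply: cvgM; first exact: cphi.
  exact: (locally_lipschitz_continuous (u_lip s0)).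
have dd (s x : R) : 0 < s -> is_derive s 1 (fun r => phi x * u r x) (phi x * ut s x).
  move=> s0; have := @is_deriveZ R R^o R^o (u ^~ x) (phi x) s 1 (ut s x) (u_derive x s0).
  exact.
have derf s x : `]t / 2, 2 * t[%classic s -> B x ->
    derivable (fun r => phi x * u r x) s 1.
  by move=> /pos s0 _; apply: ex_derive; exact: dd.
have p1 s x : 0 < s -> partial1of2 (fun r y => phi y * u r y) s x = phi x * ut s x.
  by move=> s0; rewrite /partial1of2 derive1E; have [_ ->] := dd s x s0.
have [N0 utN] := @ut_rectangle_bound (t / 2) (2 * t) A (divr_gt0 t0 (ltr0Sn R 1)).
have dom s x : `]t / 2, 2 * t[%classic s -> B x ->
    `|partial1of2 (fun r y => phi y * u r y) s x| <= `|phi x| * `|N0|.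
  move=> h; rewrite p1; last exact: pos.
  move=> Bx; rewrite normrM ler_wpM2l// (le_trans _ (ler_norm _))//.
  apply: utN; first by move: h; rewrite /= in_itv/= => /andP[/ltW -> /ltW ->].
  by move: Bx; rewrite /B /= in_itv.
have domi : leb.-integrable B (EFin \o (fun x => `|phi x| * `|N0|)).
  apply: continuous_compact_integrable; first exact: segment_compact.
  apply: continuous_subspaceT => x; apply: cvgMl.
  by apply: cvg_norm; exact: cphi.
have dom0 x : 0 <= `|phi x| * `|N0| by rewrite mulr_ge0.
have mB : measurable B by rewrite /B; exact: measurable_itv.
have dG := @derivable_under_integral R _ _ leb (fun s x => phi x * u s x) B mB
  t _ _ Nuab intf derf _ dom0 domi dom.
have vG := @differentiation_under_integral R _ _ leb (fun s x => phi x * u s x) B mB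
  t _ _ Nuab intf derf _ dom0 domi dom.
split; first exact: dG.
rewrite -derive1E vG.
transitivity (\int[leb]_(x in B) (phi x * ut t x)).
  by apply: eq_Rintegral => x _; rewrite p1.
pose J x := u t x * hilbert (m t) x.
have cut x : {for x, continuous (ut t)}.
  have ctx : ((t : R^o), (y : R^o)) @[y --> (x : R^o)] --> (nbhs (t : R^o), nbhs (x : R^o)).
    by apply: cvg_pair; [exact: cvg_cst|exact: cvg_id].
  exact: (cvg_comp _ _ ctx (@ut_continuous (t, x) t0)).
have NAA : - A < A by rewrite gtrN.
have ibp : \int[leb]_(x in B) (phi x * - ut t x) =
    (phi A * J A - phi (- A) * J (- A)) - \int[leb]_(x in B) (dphi x * J x).
  apply: Rintegration_by_parts => //.
  - apply: continuous_subspaceT; exact: lipschitz_continuous dphiM.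
  - split.
    + by move=> x _; apply: ex_derive; exact: phi_derive.
    + exact/cvg_at_right_filter/cphi.
    + exact/cvg_at_left_filter/cphi.
  - by move=> x _; rewrite derive1E; have [_ ->] := phi_derive x.
  - by apply: continuous_subspaceT => x; apply: cvgN; exact: cut.
  - split.
    + by move=> x _; apply: ex_derive; exact: flux_derive.
    + exact/cvg_at_right_filter/(is_derive_continuous (flux_derive _ t0)).
    + exact/cvg_at_left_filter/(is_derive_continuous (flux_derive _ t0)).
  - by move=> x _; rewrite derive1E; have [_ ->] := flux_derive x t0.
have iut : leb.-integrable B (EFin \o (fun x => phi x * ut t x)).
  apply: continuous_compact_integrable; first exact: segment_compact.
  by apply: continuous_subspaceT => x; apply: cvgM; [exact: cphi|exact: cut].
have -> : \int[leb]_(x in B) (phi x * ut t x) =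
    - \int[leb]_(x in B) (phi x * - ut t x).
  rewrite -[RHS]mulN1r -RintegralZl//; last first.
    apply: continuous_compact_integrable; first exact: segment_compact.
    apply: continuous_subspaceT => x; apply: cvgM; first exact: cphi.
    by apply: cvgN; exact: cut.
  by apply: eq_Rintegral => x _; rewrite mulrN mulN1r opprK.
(* [phi_out] is non-strict, so [phi] vanishes at both [A] and [- A] and the boundary terms drop. *)
rewrite ibp !phi_out ?normrN ?(ger0_norm (ltW A0))// !mul0r subrr sub0r opprK.
rewrite RintegralB_out//.
rewrite -(@weak_hilbert_compact _ (m t) (u t) (measurable_flow t0) (mu_density t0)
  (u_lip t0) dphi A C M)//.
rewrite (Rintegral_density (measurable_flow t0) (mu_density t0)); last first.
  by apply: measurable_funM => //; exact: mH.
by apply: eq_Rintegral => x _; rewrite /J; ring.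
Unshelve. all: by end_near. Qed.

Hypothesis narrow0 : narrow_cvg 0^'+ m (m 0).
Hypothesis phi_bound : exists N : R, forall x, `|phi x| <= N.

(** Total variation gives the continuity of the integrand at positive times; narrow convergence,
    which tests bounded continuous functions, handles time [0]. *)
Lemma weak_form_compact s t : 0 <= s -> s <= t ->
  leb.-integrable `[s, t] (EFin \o (fun r => pair_form (m r) dphi)) /\
  \int[m t]_x phi x - \int[m s]_x phi x =
  \int[leb]_(r in `[s, t]) pair_form (m r) dphi.
Proof.
apply: (@ftc_right0 _ (fun s => \int[m s]_x phi x)
  (fun r => pair_form (m r) dphi) M).
- move=> r r0; apply: (@continuous_total_variation _ r M r0) => s' s0.
  exact: (pair_form_density_sub M0 dphiM (measurable_flow s0) (mu_density s0)
    (measurable_flow r0) (mu_density r0)).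
- by move=> r _; exact: pair_form_bound.
- exact: weak_derive.
- by apply: narrow0.
Qed.

End compact_test.
End flow.

(** * Cut-offs with Lipschitz derivative *)

Section smooth_cutoff.
Context {R : realType}.
Implicit Types (x y z N : R).

(** Squaring smooths the corner of the positive part just enough: the derivative exists everywhere
    and is Lipschitz. *)
Lemma is_derive_sqr_pos_part z :
  is_derive z 1 (fun y : R => Num.max 0 y ^+ 2) (2 * Num.max 0 z).
Proof.
apply: (@is_derive_quadratic _ _ _ _ 1) => y; rewrite mul1r ler_norml.
have y2 := sqr_ge0 y; have z2 := sqr_ge0 z; have yz2 := sqr_ge0 (y - z).
have zy1 : 0 <= z -> y < 0 -> z * y <= 0.
  by move=> hz hy; rewrite mulr_ge0_le0// ltW.
have zy2 : z < 0 -> 0 <= y -> z * y <= 0.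
  by move=> hz hy; rewrite mulr_le0_ge0// ltW.
case: (leP 0 z) => hz; case: (leP 0 y) => hy;
  rewrite ?expr0n ?mulr0 ?mul0r /=; apply/andP; split; try lra.
Qed.

(** The square of the truncated parabola has a Lipschitz derivative, the regularity asked of test
    functions. After scaling, that derivative has size [1 / N] and Lipschitz constant of order
    [1 / N^2], which leaves room for a factor growing linearly. *)
Definition parabola N x : R := Num.max 0 (1 - (x / N) ^+ 2).
Definition bump N x : R := parabola N x ^+ 2.
Definition dbump N x : R := - (4 * N^-1) * (x / N * parabola N x).

Section positive_radius.
Variable N : R.
Hypothesis N1 : 1 <= N.

Let N0 : 0 < N. Proof. exact: lt_le_trans N1. Qed.

Lemma is_derive_bump x : is_derive x 1 (bump N) (dbump N x).
Proof.
have h1 : is_derive x 1 (fun x => 1 - (x / N) ^+ 2) (- (2 * x / N ^+ 2)).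
  apply: (@is_derive_quadratic _ _ _ _ (N ^- 2)) => z.
  have -> : 1 - (z / N) ^+ 2 - (1 - (x / N) ^+ 2) - - (2 * x / N ^+ 2) * (z - x) =
    - (N ^- 2 * (z - x) ^+ 2) by field; rewrite gt_eqF.
  by rewrite normrN ger0_norm// mulr_ge0 ?sqr_ge0// invr_ge0 sqr_ge0.
have h2 := @is_derive1_comp R _ _ x _ _ (is_derive_sqr_pos_part (1 - (x / N) ^+ 2)) h1.
apply: (is_derive_eq h2).
by rewrite /dbump /parabola; field; rewrite gt_eqF.
Qed.

Lemma parabola_out x : N <= `|x| -> parabola N x = 0.
Proof.
move=> Nx; apply/max_idPl; rewrite subr_le0 -(real_normK (num_real (x / N))).
rewrite normrM normfV (gtr0_norm N0) expr_ge1 ?divr_ge0 ?(ltW N0)//.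
by rewrite ler_pdivlMr// mul1r.
Qed.

Lemma bump_out x : N <= `|x| -> bump N x = 0.
Proof. by move=> /parabola_out h; rewrite /bump h expr0n. Qed.

Lemma dbump_out x : N <= `|x| -> dbump N x = 0.
Proof. by move=> /parabola_out h; rewrite /dbump h !mulr0. Qed.

Lemma parabola_ge0 x : 0 <= parabola N x.
Proof. by rewrite le_max lexx. Qed.

Lemma parabola_le1 x : parabola N x <= 1.
Proof. by rewrite ge_max ler01 gerBl sqr_ge0. Qed.

Lemma bump_ge0 x : 0 <= bump N x. Proof. exact: sqr_ge0. Qed.

Lemma bump_le1 x : bump N x <= 1.
Proof. by rewrite /bump expr_le1 ?parabola_ge0 ?parabola_le1. Qed.

Lemma unit_parabola_lipschitz (a b : R) :
  `|Num.max 0 (1 - a ^+ 2) - Num.max 0 (1 - b ^+ 2)| <= 2 * `|a - b|.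
Proof.
have t1 := ler_dist_dist a b; move: t1; rewrite ler_norml => /andP[].
rewrite -(real_normK (num_real a)) -(real_normK (num_real b)).
have := normr_ge0 a; have := normr_ge0 b; have := normr_ge0 (a - b).
move: `|a - b| `|a| `|b| => t {}a {}b t0 b0 a0 h1 h2.
rewrite ler_norml.
case: (leP 0 (1 - a ^+ 2)) => ha; case: (leP 0 (1 - b ^+ 2)) => hb;
  rewrite ?subr0 ?sub0r; apply/andP; split; try lra.
- have a1 : a <= 1 by nra.
  have b1 : b <= 1 by nra.
  by nra.
- have a1 : a <= 1 by nra.
  have b1 : b <= 1 by nra.
  by nra.
- have a1 : a <= 1 by nra.
  have b1 : 1 < b by nra.
  by nra.
- have b1 : b <= 1 by nra.
  have a1 : 1 < a by nra.
  by nra.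
Qed.

(** On [[-1, 1]] the slope is [1 - (a^2 + a b + b^2)], which lies between [-2] and [1]; [out] treats
    a point outside. *)
Lemma unit_cubic_lipschitz (a b : R) :
  `|a * Num.max 0 (1 - a ^+ 2) - b * Num.max 0 (1 - b ^+ 2)| <= 2 * `|a - b|.
Proof.
have out (c d : R) : 0 <= 1 - c ^+ 2 -> 1 - d ^+ 2 < 0 ->
    `|c * (1 - c ^+ 2)| <= 2 * `|c - d|.
  move=> hc hd; have c1 : c <= 1 by nra.
  have c2 : - 1 <= c by nra.
  have h1 := ler_norm (c - d); have := ler_norm (d - c); rewrite distrC => h2.
  rewrite ler_norml; have [d0|d0] := leP 0 d.
    have d1 : 1 < d by nra.
    by apply/andP; split; nra.
  have d1 : d < - 1 by nra.
  by apply/andP; split; nra.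
case: (leP 0 (1 - a ^+ 2)) => ha; case: (leP 0 (1 - b ^+ 2)) => hb.
- have -> : a * (1 - a ^+ 2) - b * (1 - b ^+ 2) =
    (1 - (a ^+ 2 + a * b + b ^+ 2)) * (a - b) by ring.
  rewrite normrM ler_wpM2r// ler_norml.
  have := sqr_ge0 (a + b); have := sqr_ge0 (a - b) => h1 h2.
  by apply/andP; split; lra.
- by rewrite mulr0 subr0; exact: out.
- by rewrite mulr0 sub0r normrN distrC; exact: out.
- by rewrite !mulr0 subrr normr0 mulr_ge0.
Qed.

Lemma bump_lipschitz x y : `|bump N x - bump N y| <= 4 * N^-1 * `|x - y|.
Proof.
have -> : bump N x - bump N y =
  (parabola N x + parabola N y) * (parabola N x - parabola N y).
  by rewrite /bump; ring.
rewrite normrM.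
apply: (@le_trans _ _ (2 * (2 * `|x / N - y / N|))).
  apply: ler_pM => //; last exact: unit_parabola_lipschitz.
  rewrite ger0_norm ?addr_ge0 ?parabola_ge0//.
  by have := parabola_le1 x; have := parabola_le1 y; lra.
rewrite -mulrBl normrM normfV (gtr0_norm N0); lra.
Qed.

Lemma dbump_lipschitz x y :
  `|dbump N x - dbump N y| <= 8 * N^-1 * N^-1 * `|x - y|.
Proof.
have N4 : 0 <= 4 * N^-1 by rewrite mulr_ge0// invr_ge0 ltW.
rewrite /dbump -mulrBr normrM normrN (ger0_norm N4).
apply: (@le_trans _ _ (4 * N^-1 * (2 * `|x / N - y / N|))).
  by rewrite ler_wpM2l//; exact: unit_cubic_lipschitz.
rewrite -mulrBl normrM normfV (gtr0_norm N0); lra.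
Qed.

Lemma dbump_bound x : `|dbump N x| <= 4 * N^-1.
Proof.
have N4 : 0 <= 4 * N^-1 by rewrite mulr_ge0// invr_ge0 ltW.
rewrite /dbump normrM normrN (ger0_norm N4).
rewrite -[leRHS]mulr1 ler_wpM2l ?mulr_ge0 ?invr_ge0 ?(ltW N0)//.
have [h|h] := leP N `|x|; first by rewrite parabola_out// mulr0 normr0.
rewrite normrM -[leRHS]mulr1; apply: ler_pM => //.
  by rewrite normrM normfV (gtr0_norm N0) ler_pdivrMr// mul1r ltW.
by rewrite ger0_norm ?parabola_ge0// parabola_le1.
Qed.

(** The product is expanded about a point of [[-N, N]], so [g] needs a bound there only and may grow
    at infinity. *)
Lemma lipschitz_mul_supported (f g : R -> R) (F F0 G G0 : R) :
  (forall x, N <= `|x| -> f x = 0) ->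
  (forall x y, `|f x - f y| <= F * `|x - y|) -> (forall x, `|f x| <= F0) ->
  (forall x y, `|g x - g y| <= G * `|x - y|) ->
  (forall x, `|x| <= N -> `|g x| <= G0) ->
  forall x y, `|f x * g x - f y * g y| <= (F * G0 + F0 * G) * `|x - y|.
Proof.
move=> f0 fF fF0 gG gG0.
have inn x y : `|x| <= N ->
    `|f x * g x - f y * g y| <= (F * G0 + F0 * G) * `|x - y|.
  move=> xN.
  have -> : f x * g x - f y * g y = (f x - f y) * g x + f y * (g x - g y) by ring.
  apply: le_trans (ler_normD _ _) _; rewrite [leRHS]mulrDl; apply: lerD.
    by rewrite normrM mulrAC; apply: ler_pM => //; exact: gG0.
  by rewrite normrM -mulrA; apply: ler_pM.
move=> x y; have [xN|xN] := leP `|x| N; first exact: inn.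
have [yN|yN] := leP `|y| N; first by rewrite distrC [`|x - y|]distrC; exact: inn.
rewrite (f0 _ (ltW xN)) (f0 _ (ltW yN)) !mul0r subrr normr0.
rewrite mulr_ge0// addr_ge0// mulr_ge0//.
- have := le_trans (normr_ge0 _) (fF N 0).
  by rewrite subr0 pmulr_lge0// normr_gt0 gt_eqF.
- have N00 : `|0 : R| <= N by rewrite normr0 ltW.
  exact: (le_trans (normr_ge0 _) (gG0 0 N00)).
- exact: (le_trans (normr_ge0 _) (fF0 0)).
- have := le_trans (normr_ge0 _) (gG N 0).
  by rewrite subr0 pmulr_lge0// normr_gt0 gt_eqF.
Qed.

End positive_radius.

Lemma cvg_bump x : bump n.+1%:R x @[n --> \oo] --> (1 : R).
Proof.
have h : (1 - (x / n.+1%:R) ^+ 2) ^+ 2 @[n --> \oo] --> ((1 - (x * 0) ^+ 2) ^+ 2 : R).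
  have hx : x / n.+1%:R @[n --> \oo] --> (x * 0 : R).
    by apply: cvgMr; exact: cvg_harmonic.
  by apply: cvgM; apply: cvgB; try exact: cvg_cst; apply: cvgM.
rewrite mulr0 expr0n/= subr0 expr1n in h.
apply: cvg_trans h; apply: near_eq_cvg; near=> n.
rewrite /bump /parabola max_r// subr_ge0 -(real_normK (num_real (x / _))).
rewrite expr_le1// normrM normfV (ger0_norm (_ : 0 <= n.+1%:R))//.
rewrite ler_pdivrMr ?ltr0n// mul1r; near: n.
have := @nbhs_infty_ger R `|x|; apply: filterS => n h'.
by rewrite (le_trans h')// ler_nat.
Unshelve. all: by end_near. Qed.

End smooth_cutoff.

(** * The weak form for test functions of linear growth *)

Section weak_form.
Context {R : realType}.
Local Notation borelR := (measurableTypeR R).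
Local Notation leb := (@lebesgue_measure R).
Variables (m : R -> probability borelR R) (u ut : R -> R -> R).
Hypothesis mu_density : forall t : R, 0 < t -> has_density (m t) (u t).
Hypothesis u_lip : forall t : R, 0 < t -> locally_lipschitz (u t).
Hypothesis u_derive : forall t x : R, 0 < t -> is_derive t 1 (u ^~ x) (ut t x).
Hypothesis ut_continuous : forall p : R^o * R^o, 0 < p.1 ->
  {for p, continuous (fun z : R^o * R^o => ut z.1 z.2 : R^o)}.
Hypothesis flux_derive : forall t x : R, 0 < t ->
  is_derive x 1 (fun y => u t y * hilbert (m t) y) (- ut t x).
Hypothesis narrow0 : narrow_cvg 0^'+ m (m 0).
Hypothesis m_P2 : forall t, 0 <= t -> finite_second_moment (m t).

Lemma integrable_first_moment t : 0 <= t ->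
  (m t).-integrable setT (EFin \o (fun x : R => `|x|)).
Proof.
move=> t0; have i2 : (m t).-integrable setT (EFin \o (fun x : R => x ^+ 2)).
  apply/integrableP; split; first by apply/measurable_EFinP; exact: measurable_funX.
  under eq_integral do rewrite /= ger0_norm ?sqr_ge0//.
  exact: m_P2.
apply: (@dominated_integrable _ _ _ (m t) setT _ (fun x => 1 + x ^+ 2));
  [by []|exact: normr_measurable| | ].
  by apply: integrable_EFinD => //; exact: finite_measure_integrable_cst.
move=> x _; rewrite normr_id -(real_normK (num_real x)).
by have := normr_ge0 x; nra.
Qed.

Variables (phi dphi : R -> R) (C M : R).
Hypothesis M0 : 0 <= M.
Hypothesis phi_derive : forall x : R, is_derive x 1 phi (dphi x).
Hypothesis dphiM : forall x y, `|dphi x - dphi y| <= M * `|x - y|.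
Hypothesis dphiC : forall x, `|dphi x| <= C.

Let C0 : 0 <= C. Proof. exact: (le_trans (normr_ge0 _) (dphiC 0)). Qed.

Let philip x y : `|phi x - phi y| <= C * `|x - y|.
Proof. exact: is_derive_lipschitz. Qed.

Let phi_growth x : `|phi x| <= `|phi 0| + C * `|x|.
Proof.
have -> : phi x = phi 0 + (phi x - phi 0) by ring.
by apply: le_trans (ler_normD _ _) _; rewrite lerD2l -{2}(subr0 x).
Qed.

Lemma lipschitz_test_integrable t : 0 <= t -> (m t).-integrable setT (EFin \o phi).
Proof.
move=> t0; apply: (@dominated_integrable _ _ _ (m t) setT _
  (fun x => `|phi 0| + C * `|x|)) => //.
- exact: lipschitz_measurable philip.
- apply: integrable_EFinD => //; first exact: finite_measure_integrable_cst.
  by apply: integrable_EFinZl => //; exact: integrable_first_moment.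
Qed.

(** Apply the compact case to [bump * phi] and let the radius grow. The space integrals are
    dominated by [|phi|], integrable thanks to the moments, and the time integrals by a Lipschitz
    constant uniform in [n]. *)
Lemma weak_form s t : 0 <= s -> s <= t ->
  leb.-integrable `[s, t] (EFin \o (fun r => pair_form (m r) dphi)) /\
  \int[m t]_x phi x - \int[m s]_x phi x =
  \int[leb]_(r in `[s, t]) pair_form (m r) dphi.
Proof.
move=> s0 st; have t0 : 0 <= t := le_trans s0 st.
pose N n : R := n.+1%:R.
have N1 n : 1 <= N n by rewrite ler1n.
have N0 n : 0 < N n by rewrite ltr0n.
have Ni n : (N n)^-1 <= 1 by rewrite invf_le1// N1.
have NV n : (N n)^-1 * N n = 1 by rewrite mulVf// gt_eqF.
have Ni0 n : 0 <= (N n)^-1 by rewrite invr_ge0 ltW.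
pose f n x := bump (N n) x * phi x.
pose df n x := dbump (N n) x * phi x + bump (N n) x * dphi x.
have fd n (x : R) : is_derive x 1 (f n) (df n x).
  have h := @is_deriveM R _ (bump (N n)) phi x 1 _ _ (is_derive_bump (N1 n) x) (phi_derive x).
  by apply: (is_derive_eq h); rewrite /df /GRing.scale /=; ring.
pose a := `|phi 0| + C.
have a0 : 0 <= a by rewrite addr_ge0.
have phiN n x : `|x| <= N n -> `|phi x| <= a * N n.
  move=> xN; apply: (le_trans (phi_growth x)); rewrite mulrDl; apply: lerD.
    by rewrite ler_peMr// N1.
  by rewrite ler_wpM2l.
have bump_norm n x : `|bump (N n) x| <= 1.
  by rewrite ger0_norm ?bump_ge0// bump_le1.
(* With [|phi| <= a * N] on the support, the derivative of the product has Lipschitz constant at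
   most [8 * a / N + 4 * C / N + 4 * C / N + M]; then [1 / N <= 1]. *)
pose M' := 8 * a + 8 * C + M.
have M'0 : 0 <= M' by rewrite !addr_ge0// mulr_ge0.
have dfM n x y : `|df n x - df n y| <= M' * `|x - y|.
  have -> : df n x - df n y =
    (dbump (N n) x * phi x - dbump (N n) y * phi y) +
    (bump (N n) x * dphi x - bump (N n) y * dphi y) by rewrite /df; ring.
  have h1 := lipschitz_mul_supported (N1 n) (dbump_out (N1 n)) (dbump_lipschitz (N1 n))
    (dbump_bound (N1 n)) philip (phiN n) x y.
  have h2 := lipschitz_mul_supported (N1 n) (bump_out (N1 n)) (bump_lipschitz (N1 n))
    (bump_norm n) dphiM (fun x _ => dphiC x) x y.
  apply: (le_trans (ler_normD _ _)); apply: (le_trans (lerD h1 h2)).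
  rewrite -mulrDl ler_wpM2r//.
  have -> : 8 / N n / N n * (a * N n) = 8 * a * (N n)^-1 * ((N n)^-1 * N n) by ring.
  rewrite NV mulr1 mul1r /M'.
  have := ler_wpM2l a0 (Ni n); have := ler_wpM2l C0 (Ni n).
  by move: (N n)^-1 => k; rewrite !mulr1 => h3 h4; lra.
have dfC n x : `|df n x| <= 4 * a + C.
  rewrite /df; apply: (le_trans (ler_normD _ _)); apply: lerD; last first.
    by rewrite normrM -[leRHS]mul1r; apply: ler_pM.
  have [h|h] := leP (N n) `|x|.
    by rewrite dbump_out// mul0r normr0 mulr_ge0.
  rewrite normrM; apply: (@le_trans _ _ (4 * (N n)^-1 * (a * N n))).
    by apply: ler_pM => //; [exact: dbump_bound|exact/phiN/ltW].
  have -> : 4 * (N n)^-1 * (a * N n) = 4 * a * ((N n)^-1 * N n) by ring.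
  by rewrite NV mulr1.
have fout n x : N n <= `|x| -> f n x = 0.
  by move=> h; rewrite /f bump_out// mul0r.
have dfout n x : N n <= `|x| -> df n x = 0.
  by move=> h; rewrite /df bump_out// dbump_out// !mul0r addr0.
have fb n : exists B : R, forall x, `|f n x| <= B.
  exists (a * N n) => x; have [h|h] := leP (N n) `|x|.
    by rewrite fout// normr0 mulr_ge0// ltW.
  rewrite normrM -[leRHS]mul1r; apply: ler_pM => //; exact/phiN/ltW.
have wf n := weak_form_compact mu_density u_lip u_derive ut_continuous flux_derive
  (N0 n) M'0 (fd n) (dfM n) (dfC n) (fout n) (dfout n) narrow0 (fb n) s0 st.
have dfcvg x : df n x @[n --> \oo] --> dphi x.
  have l1 : dbump (N n) x * phi x @[n --> \oo] --> 0 * phi x.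
    apply: cvgMl; apply: norm_cvg0.
    apply: (@squeeze_cvgr _ _ _ _ (cst 0) (fun n => 4 * (N n)^-1)).
    - by apply: nearW => n; rewrite normr_ge0/= dbump_bound.
    - exact: cvg_cst.
    - by rewrite -[X in _ --> X](mulr0 4); apply: cvgMr; exact: cvg_harmonic.
  have l2 : bump (N n) x * dphi x @[n --> \oo] --> 1 * dphi x.
    by apply: cvgMl; exact: cvg_bump.
  rewrite -[X in _ --> X]add0r -[X in _ --> _ + X]mul1r -[X in _ --> X + _](mul0r (phi x)).
  exact: (cvgD l1 l2).
have [|||||Wi lr] := @Rdominated_convergence _ _ _ leb `[s, t]
  (fun n r => pair_form (m r) (df n)) (fun r => pair_form (m r) dphi) (cst M').
- by [].
- by move=> n; apply/measurable_EFinP; exact: (measurable_int _ (wf n).1).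
- apply: measurable_bounded_integrable => //; last exact: bounded_cst.
  by rewrite [X in (X < _)%E]lebesgue_measure_itv/=; case: ifP => _; rewrite -?EFinB ltry.
- by move=> n r _; exact: pair_form_bound.
- by move=> r _; exact: (@cvg_pair_form _ (m r) df dphi M' M'0 dfM dfcvg).
split => //.
have ll r : 0 <= r -> \int[m r]_x f n x @[n --> \oo] --> \int[m r]_x phi x.
  move=> r0; have [||||_ //] := @Rdominated_convergence _ _ _ (m r) setT f phi
      (fun x => `|phi x|) measurableT.
  - by move=> n; apply: lipschitz_measurable (is_derive_lipschitz (fd n) (dfC n)).
  - exact: (integrable_norm (lipschitz_test_integrable r0)).
  - by move=> n x _; rewrite normrM -[leRHS]mul1r; apply: ler_pM.
  - by move=> x _; rewrite -[X in _ --> X]mul1r; apply: cvgMl; exact: cvg_bump.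
have lw := cvgB (ll t t0) (ll s s0).
have lw' : \int[leb]_(r in `[s, t]) pair_form (m r) (df n) @[n --> \oo] -->
    \int[m t]_x phi x - \int[m s]_x phi x.
  have -> : (fun n => \int[leb]_(r in `[s, t]) pair_form (m r) (df n)) =
    (fun n => \int[m t]_x f n x - \int[m s]_x f n x).
    by apply/funext => n; rewrite (wf n).2.
  exact: lw.
exact: (cvg_unique _ lw' lr).
Qed.

End weak_form.

(** * The regularized entropy *)

Section log_kernel.
Context {R : realType}.
Local Notation borelR := (measurableTypeR R).
Local Notation leb := (@lebesgue_measure R).
Local Notation q := (@conj_poisson R).

Lemma is_derive_taylor (f df : R -> R) (L : R) :
  (forall x : R, is_derive x 1 f (df x)) ->
  (forall x y, `|df x - df y| <= L * `|x - y|) ->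
  forall x z, `|f z - f x - df x * (z - x)| <= L * (z - x) ^+ 2.
Proof.
move=> fd dfL.
(* The point [w] at which [df] is taken may be either end of the interval, which covers both orders
   of [x] and [z]. *)
have wlogt (x z w : R) : x < z -> x <= w <= z ->
    `|f z - f x - df w * (z - x)| <= L * (z - x) ^+ 2.
  move=> xz /andP[xw wz]; have [|c /[!in_itv]/= /andP[xc cz] ->] := @MVT R f df x z xz (fun y _ => fd y).
    by apply: continuous_subspaceT => y; exact: is_derive_continuous (fd y).
  have L0 : 0 <= L.
    have := le_trans (normr_ge0 _) (dfL z x).
    by rewrite pmulr_lge0// normr_gt0 subr_eq0 gt_eqF.
  rewrite -mulrBl normrM -(real_normK (num_real (z - x))) expr2 mulrA ler_wpM2r//.
  apply: (le_trans (dfL _ _)); rewrite ler_wpM2l// [leRHS]gtr0_norm ?subr_gt0//.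
  by rewrite ler_norml; apply/andP; split; lra.
move=> x z; case: (ltgtP x z) => [xz|zx|->].
- by apply: wlogt => //; rewrite lexx ltW.
- have := @wlogt z x x zx; rewrite lexx ltW// => /(_ isT).
  have -> : f x - f z - df x * (x - z) = - (f z - f x - df x * (z - x)) by ring.
  have -> : (x - z) ^+ 2 = (z - x) ^+ 2 by ring.
  by rewrite normrN.
- by rewrite !subrr mulr0 subrr normr0 expr0n mulr0.
Qed.

Definition log_kernel (e h : R) : R := 2^-1 * ln (h ^+ 2 + e ^+ 2).
Local Notation k := log_kernel.

Section fixed_scale.
Variable e : R.
Hypothesis e0 : 0 < e.

Lemma log_kernelN h : k e (- h) = k e h.
Proof. by rewrite /k sqrrN. Qed.

Lemma is_derive_log_kernel (h : R) : is_derive h 1 (k e) (q e h).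
Proof.
have d0 := conj_poisson_den h e0.
have h1 : is_derive h 1 (fun h : R => h ^+ 2 + e ^+ 2) (2 * h).
  apply: (@is_derive_quadratic _ _ _ _ 1) => z.
  have -> : z ^+ 2 + e ^+ 2 - (h ^+ 2 + e ^+ 2) - 2 * h * (z - h) = (z - h) ^+ 2 by ring.
  by rewrite mul1r ger0_norm ?sqr_ge0.
have h2 := @is_derive1_comp R _ _ h _ _ (is_derive1_ln d0) h1.
have h3 := @is_deriveZ R R^o R^o _ 2^-1 h 1 _ h2.
by apply: (is_derive_eq h3); rewrite /conj_poisson /GRing.scale/=; field; rewrite gt_eqF.
Qed.

Lemma log_kernel_lipschitz x y : `|k e x - k e y| <= e^-1 * `|x - y|.
Proof.
apply: (is_derive_lipschitz is_derive_log_kernel) => h; exact: conj_poisson_bound.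
Qed.

Lemma log_kernel_growth h : `|k e h| <= `|k e 0| + e^-1 * `|h|.
Proof.
have -> : k e h = k e 0 + (k e h - k e 0) by ring.
apply: (le_trans (ler_normD _ _)); rewrite lerD2l -{2}(subr0 h).
exact: log_kernel_lipschitz.
Qed.

Lemma measurable_log_kernel : measurable_fun setT (k e).
Proof. exact: (lipschitz_measurable log_kernel_lipschitz). Qed.

Definition potential (mu : probability borelR R) (x : R) : R := \int[mu]_y k e (x - y).

Definition regularized_entropy (mu : probability borelR R) : R :=
  2^-1 * \int[mu]_x potential mu x.

Lemma measurable_log_kernel_sub :
  measurable_fun [set: borelR * borelR] (fun z => k e (z.1 - z.2)).
Proof.
by apply: (measurableT_comp measurable_log_kernel); exact: measurable_funB.
Qed.

Lemma log_kernel_sub_growth x y :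
  `|k e (x - y)| <= (`|k e 0| + e^-1 * `|x|) + e^-1 * `|y|.
Proof.
apply: (le_trans (log_kernel_growth _)); rewrite -addrA lerD2l -mulrDr.
by rewrite ler_wpM2l ?ler_normB// invr_ge0 ltW.
Qed.

Section first_moment.
Variable mu : probability borelR R.
Hypothesis mu1 : mu.-integrable setT (EFin \o (fun x : R => `|x|)).

Lemma integrable_growth (a b : R) :
  mu.-integrable setT (EFin \o (fun x : R => a + b * `|x|)).
Proof.
apply: integrable_EFinD => //; first exact: finite_measure_integrable_cst.
exact: integrable_EFinZl.
Qed.

Lemma integrable_growth0 (b : R) : mu.-integrable setT (EFin \o (fun x : R => b * `|x|)).
Proof. exact: integrable_EFinZl. Qed.

Lemma log_kernel_sub_integrable x :
  mu.-integrable setT (EFin \o (fun y => k e (x - y))).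
Proof.
apply: (@dominated_integrable _ _ _ mu setT _
  (fun y => (`|k e 0| + e^-1 * `|x|) + e^-1 * `|y|)) => //.
- exact: (measurable_fun_pair2 x measurable_log_kernel_sub).
- exact: integrable_growth.
- by move=> y _; exact: log_kernel_sub_growth.
Qed.

(** The quadratic remainder of the kernel is uniform in [y], hence survives integration in [y]. *)
Lemma is_derive_potential (x : R) :
  is_derive x 1 (potential mu) (smooth_hilbert e mu x).
Proof.
apply: (@is_derive_quadratic _ _ _ _ (e ^- 2)) => z.
have ki := log_kernel_sub_integrable; have qi := conj_poisson_sub_integrable mu e0 x.
have kzi := ki z; have kxi := ki x.
have kki := integrable_EFinB measurableT kzi kxi.
have qzi := integrable_EFinZl (z - x) measurableT qi.
rewrite /potential /smooth_hilbert mulrC -RintegralZl// -RintegralB// -RintegralB//.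
apply: Rintegral_bound.
  apply/measurable_EFinP; apply: measurable_int.
  exact: (integrable_EFinB measurableT kki qzi).
move=> y; have := is_derive_taylor is_derive_log_kernel
  (fun a b => conj_poisson_lipschitz a b e0) (x - y) (z - y).
have -> : z - y - (x - y) = z - x by ring.
by rewrite mulrC.
Qed.

End first_moment.

(** The mutual energy is symmetric because the kernel is even; first moments justify the
    exchange. *)
Lemma Rintegral_potentialC (mu nu : probability borelR R) :
  mu.-integrable setT (EFin \o (fun x : R => `|x|)) ->
  nu.-integrable setT (EFin \o (fun x : R => `|x|)) ->
  \int[mu]_x potential nu x = \int[nu]_x potential mu x.
Proof.
move=> mu1 nu1; rewrite /potential.
rewrite (@Rintegral_exchange _ _ _ _ _ mu nu (fun x y => k e (x - y))
  (fun x => `|k e 0| + e^-1 * `|x|) (fun y => e^-1 * `|y|)).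
- apply: eq_Rintegral => x _; apply: eq_Rintegral => y _.
  by rewrite -log_kernelN opprB.
- exact: measurable_log_kernel_sub.
- exact: integrable_growth.
- exact: integrable_growth0.
- exact: log_kernel_sub_growth.
Qed.

End fixed_scale.
End log_kernel.

(** * The regularized entropy along the flow *)

Section regularized_flow.
Context {R : realType}.
Local Notation borelR := (measurableTypeR R).
Local Notation leb := (@lebesgue_measure R).
Local Notation q := (@conj_poisson R).
Variables (m : R -> probability borelR R) (u ut : R -> R -> R).
Hypothesis mu_density : forall t : R, 0 < t -> has_density (m t) (u t).
Hypothesis u_lip : forall t : R, 0 < t -> locally_lipschitz (u t).
Hypothesis u_derive : forall t x : R, 0 < t -> is_derive t 1 (u ^~ x) (ut t x).
Hypothesis ut_continuous : forall p : R^o * R^o, 0 < p.1 ->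
  {for p, continuous (fun z : R^o * R^o => ut z.1 z.2 : R^o)}.
Hypothesis flux_derive : forall t x : R, 0 < t ->
  is_derive x 1 (fun y => u t y * hilbert (m t) y) (- ut t x).
Hypothesis narrow0 : narrow_cvg 0^'+ m (m 0).
Hypothesis m_P2 : forall t, 0 <= t -> finite_second_moment (m t).

Variable e : R.
Hypothesis e0 : 0 < e.
Local Notation V a := (potential e (m a)).
Local Notation H a := (smooth_hilbert e (m a)).
Local Notation E t := (regularized_entropy e (m t)).
Local Notation D r := (pair_form (m r) (H r)).
Local Notation tv s t := (\int[leb]_x `|u s x - u t x|).

Let m1 t : 0 <= t -> (m t).-integrable setT (EFin \o (fun x : R => `|x|)).
Proof. by move=> t0; exact: (integrable_first_moment m_P2). Qed.

Let L0 : 0 <= e ^- 2. Proof. by rewrite invr_ge0 sqr_ge0. Qed.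

Let weak a s t : 0 <= a -> 0 <= s -> s <= t ->
  leb.-integrable `[s, t] (EFin \o (fun r => pair_form (m r) (H a))) /\
  \int[m t]_x V a x - \int[m s]_x V a x =
  \int[leb]_(r in `[s, t]) pair_form (m r) (H a).
Proof.
move=> a0; apply: (@weak_form _ m u ut mu_density u_lip u_derive ut_continuous
  flux_derive narrow0 m_P2 (V a) (H a) e^-1 (e ^- 2) L0).
- by move=> x; exact: (is_derive_potential e0 (m1 a0)).
- exact: (smooth_hilbert_lipschitz (m a) e0).
- exact: (smooth_hilbert_bound (m a) e0).
Qed.

(** With [B] the symmetric mutual energy, [B(t,t) - B(s,s) = (B(t,t) - B(s,t)) + (B(t,s) - B(s,s))].
    Each bracket tests the flow against a potential frozen at [t] or at [s]. *)
Let ED s t : 0 <= s -> s <= t -> E t - E s =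
  2^-1 * \int[leb]_(r in `[s, t]) pair_form (m r) (H t) +
  2^-1 * \int[leb]_(r in `[s, t]) pair_form (m r) (H s).
Proof.
move=> s0 st; have t0 := le_trans s0 st.
have w1 := (weak t0 s0 st).2; have w2 := (weak s0 s0 st).2.
have sym := Rintegral_potentialC e0 (m1 s0) (m1 t0).
transitivity (2^-1 * (\int[m t]_x V t x - \int[m s]_x V t x) +
  2^-1 * (\int[m t]_x V s x - \int[m s]_x V s x)).
  rewrite /regularized_entropy; move: sym.
  move: (\int[m s]_x V t x) (\int[m t]_x V s x) (\int[m t]_x V t x) (\int[m s]_x V s x).
  by move=> ? ? ? ? ->; ring.
by congr (2^-1 * _ + 2^-1 * _); [exact: w1|exact: w2].
Qed.

Let Pbound r a : `|pair_form (m r) (H a)| <= e ^- 2.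
Proof. exact: (pair_form_bound L0 (smooth_hilbert_lipschitz (m a) e0)). Qed.

Let itv_bound (W : R -> R) (c K s t : R) : s <= t ->
  leb.-integrable `[s, t] (EFin \o W) ->
  (forall r, s <= r <= t -> `|W r - c| <= K) ->
  `|\int[leb]_(r in `[s, t]) W r - c * (t - s)| <= K * (t - s).
Proof.
move=> st Wi WK.
have len : fine (leb `[s, t]) = t - s.
  rewrite [X in fine X]lebesgue_measure_itv/= lte_fin.
  by move: st; rewrite le_eqVlt => /predU1P[->|->] //; rewrite ltxx subrr.
have ci (x : R) : leb.-integrable `[s, t] (EFin \o cst x).
  apply: measurable_bounded_integrable => //; last exact: bounded_cst.
  by rewrite [X in (X < _)%E]lebesgue_measure_itv/=; case: ifP => _; rewrite -?EFinB ltry.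
have E1 (x : R) : x * (t - s) = \int[leb]_(r in `[s, t]) x by rewrite Rintegral_cst// len.
rewrite !E1 -RintegralB//; last exact: (ci c).
have Wci : leb.-integrable `[s, t] (EFin \o (fun r => W r - c)).
  by apply: integrable_EFinB => //; exact: (ci c).
apply: (le_trans (le_normr_Rintegral _ Wci)) => //.
apply: le_Rintegral => //.
- exact: (integrable_norm Wci).
- exact: (ci K).
Qed.

(** First the measure is moved, then the test function: the Lipschitz constant of [H a - H t] is at
    most [e^-2] times the total variation, because each increment of [q e] is [e^-2]-Lipschitz. *)
Let Plip r a t : 0 < r -> 0 < a -> 0 < t ->
  `|pair_form (m r) (H a) - D t| <= e ^- 2 * tv r t + e ^- 2 * tv a t.
Proof.
move=> r0 a0 t0.
have mr := measurable_flow u_lip r0; have ma := measurable_flow u_lip a0.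
have mt := measurable_flow u_lip t0.
have Ha := smooth_hilbert_lipschitz (m a) e0.
have Ht := smooth_hilbert_lipschitz (m t) e0.
apply: (le_trans (ler_distD (pair_form (m t) (H a)) _ _)); apply: lerD.
  exact: (pair_form_density_sub L0 Ha mr (mu_density r0) mt (mu_density t0)).
have T0 : 0 <= tv a t by apply: Rintegral_ge0.
rewrite (pair_formB _ L0 Ha L0 Ht); apply: pair_form_bound; first by rewrite mulr_ge0.
move=> x y.
have hb b : \int[m b]_c (q e (x - c) - q e (y - c)) = H b x - H b y.
  by rewrite RintegralB//; exact: (conj_poisson_sub_integrable (m b) e0).
have gen (a1 a2 a3 a4 : R) : a1 - a2 - (a3 - a4) = (a1 - a3) - (a2 - a4) by ring.
rewrite gen -!hb.
rewrite mulrAC.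
apply: (Rintegral_density_sub ma (mu_density a0) mt (mu_density t0)).
  by apply: measurable_funB; exact: (measurable_conj_poisson_sub e0).
move=> c; apply: (le_trans (conj_poisson_lipschitz _ _ e0)).
by have -> : x - c - (y - c) = x - y by ring.
Qed.

Let mid_dist (x y z K : R) : `|x - z| <= K -> `|y - z| <= K ->
  `|2^-1 * x + 2^-1 * y - z| <= K.
Proof. by rewrite !ler_norml => /andP[? ?] /andP[? ?]; apply/andP; split; lra. Qed.

(** Valid down to [s = 0], whence the right continuity that [ftc_right0] requires there. *)
Let Elip s t : 0 <= s -> s <= t -> `|E t - E s| <= e ^- 2 * (t - s).
Proof.
move=> s0 st; have t0 := le_trans s0 st; rewrite ED//.
have b a : 0 <= a ->
    `|\int[leb]_(r in `[s, t]) pair_form (m r) (H a)| <= e ^- 2 * (t - s).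
  move=> a0; have := @itv_bound (fun r => pair_form (m r) (H a)) 0 (e ^- 2) s t st
    (weak a0 s0 st).1.
  by rewrite mul0r subr0; apply => r _; rewrite subr0; exact: Pbound.
rewrite -[X in `|X|]subr0; apply: mid_dist; rewrite subr0; exact: b.
Qed.

(** By [ED] the increment is the mean of two time integrals whose integrands are both close to [D t]
    near [t], by [Plip]. *)
Let Eder (t : R) : 0 < t -> is_derive t 1 (fun t => E t) (D t).
Proof.
move=> t0; apply: is_derive_le => eps eps0.
have ee0 : 0 < e ^+ 2 by rewrite exprn_gt0.
(* With this threshold each of the two terms of [Plip] is at most [eps / 2]. *)
have eta0 : 0 < eps * e ^+ 2 / 2 by rewrite divr_gt0// mulr_gt0.
have := cvg_total_variation mu_density u_lip u_derive t0.
move/cvgrPdist_le => /(_ _ eta0); rewrite -filter_from_ballE => -[d /= d0 tvd].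
have d20 : 0 < Num.min d t by rewrite lt_min d0.
have tvb r : `|t - r| < Num.min d t -> e ^- 2 * tv r t <= eps / 2.
  rewrite lt_min => /andP[rd _].
  have := tvd r rd; rewrite sub0r normrN ger0_norm; last by apply: Rintegral_ge0.
  move=> h; rewrite mulrC ler_pdivrMr//; lra.
have core s w : 0 < s -> s <= w -> `|t - s| < Num.min d t -> `|t - w| < Num.min d t ->
    `|E w - E s - D t * (w - s)| <= eps * (w - s).
  move=> s0 sw hs hw; have w0 := lt_le_trans s0 sw; rewrite (ED (ltW s0) sw).
  have b a : 0 < a -> `|t - a| < Num.min d t ->
      `|\int[leb]_(r in `[s, w]) pair_form (m r) (H a) - D t * (w - s)| <= eps * (w - s).
    move=> a0 ha; apply: itv_bound => //; first exact: (weak (ltW a0) (ltW s0) sw).1.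
    move=> r /andP[sr rw]; have r0 := lt_le_trans s0 sr.
    apply: (le_trans (Plip r0 a0 t0)).
    have hr : `|t - r| < Num.min d t.
      move: hs hw; rewrite !ltr_norml => /andP[h1 h2] /andP[h3 h4].
      by apply/andP; split; lra.
    by have := tvb r hr; have := tvb a ha; lra.
  by apply: mid_dist; [exact: (b _ w0 hw)|exact: (b _ s0 hs)].
have := @cvg_id _ (nbhs t); move/cvgrPdist_lt => /(_ _ d20); apply: filterS => z zt.
have z0 : 0 < z.
  by move: zt; rewrite lt_min => /andP[_]; rewrite ltr_norml => /andP[_]; lra.
have tt' : `|t - t| < Num.min d t by rewrite subrr normr0.
case: (leP t z) => h.
  by rewrite [`|z - t|]ger0_norm ?subr_ge0//; exact: core.
rewrite [`|z - t|]ltr0_norm ?subr_lt0// opprB.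
have gen (a b c : R) : `|a - b - c * (z - t)| = `|b - a - c * (t - z)|.
  by rewrite -normrN; congr `|_|; ring.
rewrite gen; apply: core => //; exact: ltW.
Qed.

Lemma regularized_entropy_identity s t : 0 <= s -> s <= t ->
  leb.-integrable `[s, t] (EFin \o (fun r => D r)) /\
  E t - E s = \int[leb]_(r in `[s, t]) D r.
Proof.
apply: (@ftc_right0 _ (fun t => E t) (fun r => D r) (e ^- 2)).
- move=> r r0; apply: (continuous_total_variation mu_density u_lip u_derive
    (C := e ^- 2 + e ^- 2) r0) => s' s0.
  by rewrite mulrDl; exact: Plip.
- by move=> r _; exact: Pbound.
- exact: Eder.
- apply/cvgrPdist_le => eps eps0; near=> s'.
  have s0 : 0 < s' by [].
  rewrite distrC; apply: (le_trans (Elip (lexx 0) (ltW s0))); rewrite subr0.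
  have ee0 : 0 < e ^+ 2 by rewrite exprn_gt0.
  rewrite mulrC ler_pdivrMr//; apply: ltW; near: s'; apply: nbhs_right_lt.
  by rewrite mulr_gt0// exprn_gt0.
Unshelve. all: by end_near. Qed.

End regularized_flow.

(** The function [g] may have infinite integral, as happens for a measure of entropy [-oo]; both
    sides are then [-oo]. *)
Lemma integralB_ge0 d (T : measurableType d) (R : realType)
    (mu : {measure set T -> \bar R}) (f : T -> R) (g : T -> \bar R) :
  mu.-integrable setT (EFin \o f) -> measurable_fun setT g ->
  (forall x, (0 <= g x)%E) ->
  (\int[mu]_x ((f x)%:E - g x) = \int[mu]_x (f x)%:E - \int[mu]_x g x)%E.
Proof.
move=> fi mg g0; have mf : measurable_fun setT (EFin \o f) by exact: measurable_int fi.
have [goo|] := ltP (\int[mu]_x g x)%E +oo%E.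
  rewrite -integralB//; apply/integrableP; split => //.
  by under eq_integral do rewrite gee0_abs//.
rewrite leye_eq => /eqP goo; rewrite goo.
have ffin : (\int[mu]_x (f x)%:E)%E \is a fin_num by exact: (integrable_fin_num _ fi).
have -> : (\int[mu]_x (f x)%:E - +oo = -oo)%E by rewrite -(fineK ffin).
pose h x := ((f x)%:E - g x)%E.
have mh : measurable_fun setT h by exact: emeasurable_funB.
have fabs : (\int[mu]_x `|(f x)%:E| < +oo)%E by case/integrableP : fi.
have hp : (\int[mu]_x h^\+ x < +oo)%E.
  apply: le_lt_trans fabs; apply: ge0_le_integral => //.
  - exact: measurable_funepos.
  - exact: measurableT_comp.
  - move=> x _; rewrite /h funeposE ge_max abse_ge0 andbT.
    move: (g0 x); case: (g x) => [r| |]//= r0; last by rewrite leNye.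
    by rewrite lee_fin; move: r0; rewrite lee_fin; have := ler_norm (f x); lra.
(* Since [g <= |f| + h^\-] pointwise, an infinite integral of [g] forces one of the negative
   part. *)
have gfh : (\int[mu]_x g x <= \int[mu]_x `|(f x)%:E| + \int[mu]_x h^\- x)%E.
  have mabs : measurable_fun setT (fun x => `|(f x)%:E|)%E by exact: measurableT_comp.
  have mhn : measurable_fun setT (h^\-)%E by exact: measurable_funeneg.
  rewrite -ge0_integralD//; apply: ge0_le_integral => //; first exact: emeasurable_funD.
  move=> x _; rewrite /h funenegE.
  move: (g0 x); case: (g x) => [r| |]//= r0.
  rewrite -?EFinB -?EFinN -EFin_max -EFinD lee_fin.
  have h1 : - (f x - r) <= Num.max (- (f x - r)) 0 by rewrite le_max lexx.
  by have := ler_norm (f x); lra.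
have hn : (\int[mu]_x h^\- x = +oo)%E.
  apply: contrapT => /eqP; rewrite -ltey => hn.
  by move: gfh; rewrite goo leye_eq; apply/negP; rewrite -ltey lte_add_pinfty.
rewrite integralE hn.
have : (0 <= \int[mu]_x h^\+ x)%E by exact: integral_ge0.
by move: hp; case: (\int[mu]_x h^\+ x)%E.
Qed.

(** * Monotone limit of the regularized entropies *)

Section regularized_entropy_limit.
Context {R : realType}.
Local Notation borelR := (measurableTypeR R).
Local Notation k := (@log_kernel R).

Lemma harmonic_nonincreasing (n p : nat) : (n <= p)%N ->
  harmonic p <= harmonic n :> R.
Proof. by move=> np; rewrite /harmonic /= lef_pV2 ?posrE ?ltr0n// ler_nat. Qed.

Lemma log_kernel_nonincreasing h (n p : nat) : (n <= p)%N ->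
  k (harmonic p) h <= k (harmonic n) h.
Proof.
move=> np; rewrite /log_kernel ler_wpM2l// ler_ln ?posrE.
- rewrite lerD2l lerXn2r ?nnegrE ?harmonic_ge0//; exact: harmonic_nonincreasing.
- exact: (conj_poisson_den h (harmonic_gt0 p)).
- exact: (conj_poisson_den h (harmonic_gt0 n)).
Qed.

Lemma cvg_log_kernel (h : R) : (k (harmonic n) h)%:E @[n --> \oo] --> lne (`|h|%:E).
Proof.
have [->|h0] := eqVneq h 0.
  rewrite normr0 le0_lneNy//; apply/cvgeNyPler => A _.
  (* At [h = 0] the kernel equals [- ln (n + 1)], which is below [A] once [n >= expR (- A)]. *)
  have : \forall n \near \oo, expR (- A) <= n%:R by exact: nbhs_infty_ger.
  apply: filterS => n nA; rewrite lee_fin /log_kernel expr0n add0r.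
  rewrite /harmonic/= exprVn lnV ?posrE ?exprn_gt0// lnXn// mulrN lerNl.
  rewrite -[X in _ <= _ * X]mulr_natl mulrA mulVf// mul1r.
  rewrite -[leLHS]expRK ler_ln ?posrE ?expR_gt0//.
  by apply: (le_trans nA); rewrite ler_nat.
have nh0 : 0 < `|h| by rewrite normr_gt0.
rewrite lne_EFin//; apply: cvg_EFin; first exact: nearW.
have -> : ln `|h| = 2^-1 * ln (h ^+ 2).
  by rewrite -(real_normK (num_real h)) lnXn// -[X in _ * X]mulr_natl mulrA mulVf// mul1r.
have l1 : h ^+ 2 + (harmonic n) ^+ 2 @[n --> \oo] --> (h ^+ 2 : R).
  rewrite -[X in _ --> X]addr0; apply: cvgD; first exact: cvg_cst.
  rewrite -(mulr0 (0 : R)); under eq_fun do rewrite expr2.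
  by apply: cvgM; exact: cvg_harmonic.
apply: cvgMr; apply: (continuous_cvg _ _ l1); apply: continuous_ln.
by rewrite exprn_even_gt0.
Qed.

Variable mu : probability borelR R.
Hypothesis mu1 : mu.-integrable setT (EFin \o (fun x : R => `|x|)).
Local Notation V n := (potential (harmonic n) mu).

(** The kernels decrease with [n] and have no sign. Subtracting them from the one at scale
    [harmonic 0 = 1] yields a nonnegative nondecreasing sequence, fit for monotone convergence. *)
Let g_ n h : R := k (harmonic 0) h - k (harmonic n) h.
Let g h : \bar R := ((k (harmonic 0) h)%:E - lne (`|h|%:E))%E.

Let g_ge0 n h : 0 <= g_ n h.
Proof. by rewrite subr_ge0; exact: log_kernel_nonincreasing. Qed.

Let g_nd h (n p : nat) : (n <= p)%N -> g_ n h <= g_ p h.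
Proof. by move=> np; rewrite lerB//; exact: log_kernel_nonincreasing. Qed.

Let g_cvg h : (g_ n h)%:E @[n --> \oo] --> g h.
Proof.
rewrite /g_ /g; under eq_fun do rewrite EFinB.
apply: cvgeB; [|exact: cvg_cst|exact: cvg_log_kernel].
by [].
Qed.

Let g0 h : (0 <= g h)%E.
Proof.
have <- : limn (fun n => (g_ n h)%:E) = g h by apply/cvg_lim => //; exact: g_cvg.
apply: lime_ge; first by apply/cvg_ex; exists (g h); exact: g_cvg.
by apply: nearW => n; rewrite lee_fin.
Qed.

Let mgn n : measurable_fun setT (g_ n).
Proof.
by apply: measurable_funB; exact: (measurable_log_kernel (harmonic_gt0 _)).
Qed.

Let mg : measurable_fun [set: borelR] g.
Proof.
apply: (emeasurable_fun_cvg (fun n => EFin \o g_ n)).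
  by move=> n; apply/measurable_EFinP.
by move=> h _; exact: g_cvg.
Qed.

Let msub (x : R) : measurable_fun [set: borelR] (fun y : R => x - y : borelR).
Proof. by apply: measurable_funB. Qed.

Let G_ n x : R := \int[mu]_y g_ n (x - y).
Let G x : \bar R := (\int[mu]_y g (x - y))%E.

Let gxi n x : mu.-integrable setT (EFin \o (fun y => g_ n (x - y))).
Proof.
by apply: integrable_EFinB => //; apply: log_kernel_sub_integrable => //; exact: harmonic_gt0.
Qed.

Let G_E n x : G_ n x = V 0%N x - V n x.
Proof.
rewrite /G_ /potential -RintegralB//; apply: log_kernel_sub_integrable => //;
  exact: harmonic_gt0.
Qed.

Let G_EFin n x : ((G_ n x)%:E = \int[mu]_y (g_ n (x - y))%:E)%E.
Proof. by rewrite fineK//; exact: (integrable_fin_num _ (gxi n x)). Qed.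

Let G_cvg x : (G_ n x)%:E @[n --> \oo] --> G x.
Proof.
under eq_fun do rewrite G_EFin.
have := @cvg_monotone_convergence _ _ _ mu setT measurableT
  (fun n y => (g_ n (x - y))%:E).
have -> : (\int[mu]_y limn (fun n => (g_ n (x - y))%:E) = G x)%E.
  by apply: eq_integral => y _; apply/cvg_lim => //; exact: g_cvg.
apply.
- by move=> n; apply/measurable_EFinP; exact: (measurableT_comp (mgn n) (msub x)).
- by move=> n y _; rewrite lee_fin.
- by move=> y _ n p np; rewrite lee_fin g_nd.
Qed.

Let G_ge0 n x : 0 <= G_ n x.
Proof. by apply: Rintegral_ge0. Qed.

Let G_nd x (n p : nat) : (n <= p)%N -> G_ n x <= G_ p x.
Proof. by move=> np; apply: le_Rintegral => // y _; exact: g_nd. Qed.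

Let V_lipschitz n x y : `|V n x - V n y| <= (harmonic n)^-1 * `|x - y|.
Proof.
have e0 : 0 < harmonic n :> R by exact: harmonic_gt0.
apply: (@is_derive_lipschitz _ _ (smooth_hilbert (harmonic n) mu)).
  by move=> z; exact: (is_derive_potential e0 mu1).
exact: (smooth_hilbert_bound mu e0).
Qed.

Let mV n : measurable_fun setT (V n).
Proof. exact: (lipschitz_measurable (V_lipschitz n)). Qed.

Let Vi n : mu.-integrable setT (EFin \o V n).
Proof.
apply: (@dominated_integrable _ _ _ mu setT _
  (fun x => `|V n 0| + (harmonic n)^-1 * `|x|));
  [by []|exact: mV|exact: (integrable_growth mu1)| ].
move=> x _; have -> : V n x = V n 0 + (V n x - V n 0) by rewrite addrC subrK.
apply: (le_trans (ler_normD _ _)); rewrite lerD2l -{2}(subr0 x).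
exact: V_lipschitz.
Qed.

Let mGn n : measurable_fun setT (G_ n).
Proof.
by rewrite (_ : G_ n = fun x => V 0%N x - V n x); [exact: measurable_funB|exact/funext].
Qed.

Let mG : measurable_fun [set: borelR] G.
Proof.
apply: (emeasurable_fun_cvg (fun n => EFin \o G_ n)).
  by move=> n; apply/measurable_EFinP.
by move=> x _; exact: G_cvg.
Qed.

(** Monotone convergence is applied in [y] and then in [x]. The entropy is a finite number minus a
    nonnegative integral, up to a positive factor; hence it can be [-oo] but never [+oo]. *)
Lemma cvg_regularized_entropy :
  (regularized_entropy (harmonic n) mu)%:E @[n --> \oo] --> free_entropy mu /\
  (free_entropy mu < +oo)%E.
Proof.
pose v := \int[mu]_x V 0%N x.
have vE : (v%:E = \int[mu]_x (V 0%N x)%:E)%E.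
  by rewrite fineK//; exact: (integrable_fin_num _ (Vi 0%N)).
have G0 x : (0 <= G x)%E by apply: integral_ge0 => y _; exact: g0.
have IE : (\int[mu]_x \int[mu]_y lne (`|x - y|%:E) = v%:E - \int[mu]_x G x)%E.
  rewrite vE -integralB_ge0//; apply: eq_integral => x _.
  have ki := log_kernel_sub_integrable (harmonic_gt0 0%N) mu1 x.
  have -> : ((V 0%N x)%:E = \int[mu]_y (k (harmonic 0) (x - y))%:E)%E.
    by rewrite fineK//; exact: (integrable_fin_num _ ki).
  rewrite -integralB_ge0//; last exact: (measurableT_comp mg (msub x)).
  apply: eq_integral => y _; rewrite /g.
  by case: (lne _) => [r| |]//=; rewrite -!EFinB subKr.
have lim : (\int[mu]_x (G_ n x)%:E)%E @[n --> \oo] --> (\int[mu]_x G x)%E.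
  have := @cvg_monotone_convergence _ _ _ mu setT measurableT
    (fun n x => (G_ n x)%:E).
  have -> : (\int[mu]_x limn (fun n => (G_ n x)%:E) = \int[mu]_x G x)%E.
    by apply: eq_integral => x _; apply/cvg_lim => //; exact: G_cvg.
  apply.
  - by move=> n; apply/measurable_EFinP; exact: mGn.
  - by move=> n x _; rewrite lee_fin.
  - by move=> x _ n p np; rewrite lee_fin G_nd.
have IG0 : (0 <= \int[mu]_x G x)%E by exact: integral_ge0.
rewrite /free_entropy IE; split.
  have -> : (fun n => (regularized_entropy (harmonic n) mu)%:E) =
      (fun n => (2^-1)%:E * (v%:E - \int[mu]_x (G_ n x)%:E))%E.
    apply/funext => n; rewrite /regularized_entropy EFinM; congr (_ * _)%E.
    have Gi : mu.-integrable setT (EFin \o G_ n).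
      rewrite (_ : G_ n = fun x => V 0%N x - V n x); last exact/funext.
      exact: integrable_EFinB.
    have -> : (\int[mu]_x (G_ n x)%:E = (\int[mu]_x G_ n x)%:E)%E.
      by rewrite fineK//; exact: (integrable_fin_num _ Gi).
    rewrite -EFinB; congr EFin; rewrite /v -RintegralB//.
    by apply: eq_Rintegral => x _; rewrite G_E subKr.
  apply: cvgeZl => //; apply: cvgeB => //.
  exact: cvg_cst.
by move: IG0; case: (\int[mu]_x G x)%E => [r| |]//= _; rewrite ?ltry// mulrNy gtr0_sg// mul1e.
Qed.

End regularized_entropy_limit.

(** * Regularity of the density in each variable *)

Section smooth_density.
Context {R : realType}.
Variable U : R^o * R^o -> R^o.
Hypothesis smU : smooth_on [set p : R^o * R^o | 0 < p.1] U.

(** The difference quotients in time are those of the directional derivative along [(1, 0)], so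
    existence and value transfer together. *)
Lemma is_derive_time (t x : R) : 0 < t ->
  is_derive t 1 (fun s : R => U (s, x) : R) ('D_((1, 0) : R^o * R^o) U (t, x)).
Proof.
move=> t0; have [_ + _] := smU 1; move=> /(_ ((1, 0) : R^o * R^o) (t, x) t0) d.
have e : (fun h : R => h^-1 *: (((fun s : R => U (s, x) : R) \o shift t) (h *: 1) - U (t, x))) =
   (fun h : R => h^-1 *: ((U \o shift ((t, x) : R^o * R^o)) (h *: ((1, 0) : R^o * R^o)) - U (t, x))).
  apply/funext => h /=; congr (_ *: (U _ - _)).
  by congr pair; rewrite /= ?scaler0 ?add0r.
by split; rewrite /derivable /derive e.
Qed.

Lemma is_derive_space (t x : R) : 0 < t ->
  is_derive x 1 (fun y : R => U (t, y) : R) ('D_((0, 1) : R^o * R^o) U (t, x)).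
Proof.
move=> t0; have [_ + _] := smU 1; move=> /(_ ((0, 1) : R^o * R^o) (t, x) t0) d.
have e : (fun h : R => h^-1 *: (((fun y : R => U (t, y) : R) \o shift x) (h *: 1) - U (t, x))) =
   (fun h : R => h^-1 *: ((U \o shift ((t, x) : R^o * R^o)) (h *: ((0, 1) : R^o * R^o)) - U (t, x))).
  apply/funext => h /=; congr (_ *: (U _ - _)).
  by congr pair; rewrite /= ?scaler0 ?add0r.
by split; rewrite /derivable /derive e.
Qed.

Lemma continuous_derive_smooth (v p : R^o * R^o) : 0 < p.1 ->
  {for p, continuous ('D_v U)}.
Proof. by move=> p0; have [_ _ /(_ v)] := smU 1; apply. Qed.

(** Mean value theorem, with the maximum of the space derivative over [[-(|A| + 1), |A| + 1]]: the
    extra [1] makes room for [y]. *)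
Lemma smooth_locally_lipschitz (t : R) : 0 < t ->
  locally_lipschitz (fun x : R => U (t, x) : R).
Proof.
move=> t0 A; pose dU (x : R) : R := 'D_((0, 1) : R^o * R^o) U (t, x).
have cdU : continuous (fun x => `|dU x|).
  move=> x; apply: cvg_norm.
  have ctx : ((t : R^o), (y : R^o)) @[y --> (x : R^o)] --> (nbhs (t : R^o), nbhs (x : R^o)).
    by apply: cvg_pair; [exact: cvg_cst|exact: cvg_id].
  exact: (cvg_comp _ _ ctx (@continuous_derive_smooth (0, 1) (t, x) t0)).
have AA : - (`|A| + 1) <= `|A| + 1 by have := normr_ge0 A; lra.
have [c _ cmax] := EVT_max AA (continuous_subspaceT cdU).
exists `|dU c|; first exact: normr_ge0.
have wlogt (x y : R) : `|x| <= `|A| + 1 -> `|y| <= `|A| + 1 -> x < y ->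
    `|U (t, x) - U (t, y)| <= `|dU c| * `|x - y|.
  move=> xA yA xy.
  have [|z] := @MVT R (fun x => U (t, x)) dU x y xy (fun z _ => is_derive_space z t0).
    by apply: continuous_subspaceT => z; exact: (is_derive_continuous (is_derive_space z t0)).
  rewrite in_itv/= => /andP[xz zy] e.
  rewrite distrC e normrM [X in _ <= _ * X]distrC ler_wpM2r//; apply: cmax.
  move: xA yA; rewrite !ler_norml in_itv/= => /andP[h1 _] /andP[_ h2].
  by apply/andP; split; lra.
move=> x y xA xy1; have xA1 : `|x| <= `|A| + 1.
  by rewrite (le_trans xA)// (le_trans (ler_norm A))// lerDl.
have yA1 : `|y| <= `|A| + 1.
  have -> : y = x - (x - y) by ring.
  by apply: (le_trans (ler_normB _ _)); rewrite lerD// (le_trans xA)// ler_norm.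
case: (ltgtP x y) => [| |->]; first exact: wlogt.
  by move=> yx; rewrite distrC [X in _ * X]distrC; exact: wlogt.
by rewrite !subrr normr0 mulr0.
Qed.

End smooth_density.

(** * Passage to the limit in the regularized identity *)

Theorem proposition6p3 (R : realType)
    (m : R -> probability (measurableTypeR R) R)
    (m_P2 : forall t : R, 0 <= t -> finite_second_moment (m t))
    (m_sol : smooth_solution m)
    (E0 : (-oo < free_entropy (m 0%R))%E)
    (t' t : R) (t'_ge0 : 0 <= t') (t't : t' <= t) :
  (free_entropy (m t) = free_entropy (m t') +
    \int[lebesgue_measure]_(s in `[t', t])
      \int[m s]_x (hilbert (m s) x ^+ 2)%:E)%E.
Proof.
have [U [smU dens pde narrow0]] := m_sol.
pose u (s x : R) : R := U (s, x).
pose ut (s x : R) : R := 'D_((1, 0) : R^o * R^o) (U : R^o * R^o -> R^o) (s, x).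
have u_lip s : 0 < s -> locally_lipschitz (u s).
  by move=> s0; exact: smooth_locally_lipschitz.
have u_derive (s x : R) : 0 < s -> is_derive s 1 (u ^~ x) (ut s x).
  by move=> s0; exact: is_derive_time.
have ut_continuous (p : R^o * R^o) : 0 < p.1 ->
    {for p, continuous (fun z : R^o * R^o => ut z.1 z.2 : R^o)}.
  move=> p0; rewrite (_ : (fun z : R^o * R^o => _) = 'D_((1, 0) : R^o * R^o) (U : R^o * R^o -> R^o)).
    exact: continuous_derive_smooth.
  by apply/funext => -[].
have flux (s x : R) : 0 < s ->
    is_derive x 1 (fun y => u s y * hilbert (m s) y) (- ut s x).
  move=> s0; have [d e] := pde s x s0; split; first exact: d.
  have [_ tE] := u_derive s x s0.
  by move: e; rewrite !derive1E tE => e; apply/eqP; rewrite -addr_eq0 addrC e.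
have mom (s : R) : 0 <= s -> (m s).-integrable setT (EFin \o (fun x : R => `|x|)).
  exact: integrable_first_moment.
pose En n s := regularized_entropy (harmonic n) (m s).
pose Dn n r := pair_form (m r) (smooth_hilbert (harmonic n) (m r)).
have Ecvg (s : R) : 0 <= s -> (En n s)%:E @[n --> \oo] --> free_entropy (m s).
  by move=> s0; have [] := cvg_regularized_entropy (mom s s0).
have Eoo (s : R) : 0 <= s -> (free_entropy (m s) < +oo)%E.
  by move=> s0; have [] := cvg_regularized_entropy (mom s s0).
have id n a b : 0 <= a -> a <= b ->
    (@lebesgue_measure R).-integrable `[a, b] (EFin \o Dn n) /\
    En n b - En n a = \int[lebesgue_measure]_(r in `[a, b]) Dn n r.
  exact: (regularized_entropy_identity dens u_lip u_derive ut_continuous flux narrow0 m_P2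
    (harmonic_gt0 n)).
have Dn0 n r : 0 <= Dn n r by exact: pair_form_smooth_hilbert_ge0.
(* The regularized entropies are nondecreasing in time, hence so is their limit; this propagates the
   finiteness of the initial entropy to all times. *)
have Emono (s : R) : 0 <= s -> (free_entropy (m 0%R) <= free_entropy (m s))%E.
  move=> s0.
  have c0 := Ecvg 0 (lexx 0); have cs := Ecvg s s0.
  rewrite -(cvg_lim (@ereal_hausdorff R) c0) -(cvg_lim (@ereal_hausdorff R) cs).
  apply: lee_lim.
  - by apply/cvg_ex; exists (free_entropy (m 0%R)).
  - by apply/cvg_ex; exists (free_entropy (m s)).
  - apply: nearW => n; rewrite lee_fin -subr_ge0 (id n 0 s (lexx 0) s0).2.
    by apply: Rintegral_ge0.
have Efin (s : R) : 0 <= s -> free_entropy (m s) \is a fin_num.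
  move=> s0; rewrite fin_numElt Eoo// andbT; exact: lt_le_trans (Emono s s0).
have t0 := le_trans t'_ge0 t't.
pose X r := (\int[m r]_x (hilbert (m r) x ^+ 2)%:E)%E.
have X0 r : (0 <= X r)%E by apply: integral_ge0 => x _; rewrite lee_fin sqr_ge0.
(* The left endpoint may be time [0], where there may be no density; dropping it leaves the time
   integral unchanged. *)
pose T := (`]t', t]%classic : set R).
have T0 r : T r -> 0 < r.
  by rewrite /T /= in_itv/= => /andP[h _]; exact: le_lt_trans h.
have DX r : T r -> (Dn n r)%:E @[n --> \oo] --> X r.
  move=> /T0 r0; exact: (cvg_dissipation (measurable_flow u_lip r0) (dens r r0) (u_lip r r0)).
have mT : measurable T by exact: measurable_itv.
have TI : T `<=` `[t', t] by exact: subset_itv_oc_cc.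
have mD n : measurable_fun T (EFin \o Dn n).
  by apply: measurable_funS (measurable_int _ (id n _ _ t'_ge0 t't).1).
have mX : measurable_fun T X by exact: (emeasurable_fun_cvg (fun n => EFin \o Dn n)).
have DT n : (\int[lebesgue_measure]_(r in T) (Dn n r)%:E = (En n t - En n t')%:E)%E.
  rewrite (id n _ _ t'_ge0 t't).2 fineK; last first.
    exact: (integrable_fin_num _ (id n _ _ t'_ge0 t't).1).
  exact: (integral_itv_obnd_cbnd (mD n)).
have Dlim : (\int[lebesgue_measure]_(r in T) (Dn n r)%:E)%E @[n --> \oo] -->
    (free_entropy (m t) - free_entropy (m t'))%E.
  under eq_fun do rewrite DT EFinB.
  apply: cvgeB; [|exact: Ecvg|exact: Ecvg].
  by rewrite fin_num_adde_defl// fin_numN Efin.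
have Xfin : (\int[lebesgue_measure]_(r in T) X r < +oo)%E.
  (* Any number above the limit of the entropy increments eventually bounds the dissipation
     integrals. *)
  pose B := fine (free_entropy (m t) - free_entropy (m t')) + 1.
  apply: (@le_lt_trans _ _ B%:E); last exact: ltry.
  apply: (@fatou_le _ _ _ lebesgue_measure T (fun n r => (Dn n r)%:E)) => //.
    by move=> n r _; rewrite lee_fin.
  move=> N.
  have : \forall n \near \oo, (\int[lebesgue_measure]_(r in T) (Dn n r)%:E <= B%:E)%E.
    suff h : \forall n \near \oo, En n t - En n t' <= B.
      by apply: filterS h => n; rewrite DT lee_fin.
    have Er s : 0 <= s -> En n s @[n --> \oo] --> fine (free_entropy (m s)).
      move=> s0; have := Ecvg s s0; rewrite -{1}(fineK (Efin s s0)) => /fine_cvg.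
      exact.
    have LB : fine (free_entropy (m t)) - fine (free_entropy (m t')) < B.
      by rewrite /B (fineB (Efin t t0) (Efin _ t'_ge0)) ltrDl.
    exact: (cvgr_le _ (cvgB (Er t t0) (Er t' t'_ge0)) _ LB).
  move=> [p _ pB]; exists (maxn N p); first exact: leq_maxl.
  by apply: pB; exact: leq_maxr.
have Xi : (@lebesgue_measure R).-integrable T X.
  apply/integrableP; split => //; rewrite (le_lt_trans _ Xfin)//.
  by apply: ge0_le_integral => //; [exact: measurableT_comp|move=> r _; rewrite gee0_abs].
have [|||_ _ Xlim] := @dominated_convergence _ _ R lebesgue_measure T mT
  (fun n r => (Dn n r)%:E) X (fun r => 2%:E * X r)%E mD mX.
- by apply: aeW => r; exact: DX.
- exact: integrableZl.
- apply: aeW => r n /T0 r0 /=; rewrite ger0_norm//.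
  exact: (dissipation_dominated (measurable_flow u_lip r0) (dens r r0) (u_lip r r0)).
have := cvg_unique (@ereal_hausdorff R) Dlim Xlim.
rewrite /T integral_itv_obnd_cbnd// => <-.
by rewrite addeC subeK// Efin.
Qed.
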